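(* Assume the following. (1) There exists $\theta^*\in\Theta$ such that $\theta^*_{\mathbf x}=\arg\min_{t\in[-M,M]}E_{\mathbf x}\log\frac{p_{0\mathbf x}}{f_t}$ for all $\mathbf x\in\mathcal X$, and $\theta^*$ is in the sup-norm support of $\Pi$ (every sup-norm neighborhood of $\theta^*$ has positive $\Pi$-probability). (2) (a) $E_{\mathbf x}\left[\log\frac{f_t}{f_{t'}}\right]$ and, for every $\alpha\in[0,1]$, $E_{\mathbf x}\left[\left(\frac{f_t}{f_{t'}}\right)^\alpha\right]$ are continuous functions of $(\mathbf x,t,t')\in\mathcal X\times[-M,M]^2$; (b) $E_{\mathbf x}\log^2\frac{f_t}{f_{t'}}$ is bounded over $(\mathbf x,t,t')\in\mathcal X\times[-M,M]^2$. (3) For any $\eta>0$ there exists $\delta\in(0,1)$ such that $\{t\in[-M,M]:E_{\mathbf x}\log\frac{f_{\theta^*_{\mathbf x}}}{f_t}<\delta\}\subseteq\{t:|t-\theta^*_{\mathbf x}|<\eta\}$ for all $\mathbf x\in\mathcal X$. (4) $\mathcal X$ is compact with respect to the norm $\|\cdot\|$, and $\Theta$ is a compact subset of the space of continuous functions $\mathcal X\to\mathbb R$ endowed with the sup-norm metric $d$. (5) For every $\mathbf x_0\in\mathcal X$ and $\delta'>0$, with $A_{\mathbf x_0,\delta'}=\{\mathbf x:\|\mathbf x-\mathbf x_0\|<\delta'\}$, one has $\kappa(\mathbf x_0,\delta')=\liminf_{n}\frac1n\sum_{i=1}^n I_{A_{\mathbf x_0,\delta'}}(\mathbf x_i)>0$.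 Then for every $\epsilon>0$, with $U^c=\{\theta\in\Theta:d(\theta,\theta^* )>\epsilon\}$, $$\Pi_n(U^c)\to0\quad\text{almost surely } P_0\text{ as } n\to\infty.$$
   Context: $\mathcal X$ is a covariate space (a subset of a normed space with norm $\|\cdot\|$), and $\mathbf x_1,\mathbf x_2,\ldots\in\mathcal X$ are non-random covariate values. For each $\mathbf x\in\mathcal X$ there is a true density $p_{0\mathbf x}$, and $Y_1,Y_2,\ldots$ are independent with $Y_i\sim p_{0\mathbf x_i}$. $E_{\mathbf x}$ denotes expectation with respect to $p_{0\mathbf x}$ (densities inside $E_{\mathbf x}$ are evaluated at $Y\sim p_{0\mathbf x}$), $P_0=p_{0\mathbf x_1}\times p_{0\mathbf x_2}\times\cdots$ is the infinite product measure and $E$ is expectation with respect to $P_0$. $\{f_t:t\in[-M,M]\}$ is a family of densities (with respect to the same dominating measure), for a fixed $M>0$. $\Theta$ is a class of continuous functions from $\mathcal X$ to $[-M,M]$, with $\theta_{\mathbf x}$ denoting $\theta(\mathbf x)$, and sup-norm metric $d(\theta_1,\theta_2)=\sup_{\mathbf x\in\mathcal X}|\theta_1(\mathbf x)-\theta_2(\mathbf x)|$. The specified (possibly misspecified) model is $Y_i\sim f_{\theta_{\mathbf x_i}}$, $\theta\in\Theta$. $\Pi$ is a prior probability measure on $\Theta$. $I_A$ is the indicator function of $A$. Usual measurability of $(t,y)\mapsto f_t(y)$ is implicit. The posterior probability of a measurable set $B\subseteq\Theta$ is $$\Pi_n(B)=\frac{\int_B\prod_{i=1}^n\frac{f_{\theta_{\mathbf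 x_i}}(Y_i)}{f_{\theta^*_{\mathbf x_i}}(Y_i)}\,d\Pi(\theta)}{\int_\Theta\prod_{i=1}^n\frac{f_{\theta_{\mathbf x_i}}(Y_i)}{f_{\theta^*_{\mathbf x_i}}(Y_i)}\,d\Pi(\theta)}.$$ *)

(* Defs.v *)
From mathcomp Require Import all_boot all_order all_algebra.
From mathcomp Require Import all_classical all_reals all_analysis.

Set Implicit Arguments.
Unset Strict Implicit.
Unset Printing Implicit Defensive.

Import Order.TTheory GRing.Theory Num.Theory.
Import numFieldNormedType.Exports.

Local Open Scope classical_set_scope.
Local Open Scope ring_scope.

Section densities.
Context {R : realType} {d : measure_display} {Y : measurableType d}.

Definition is_density (mu : {measure set Y -> \bar R}) (p : Y -> R) :=
  [/\ measurable_fun [set: Y] p,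
      (forall y, 0 <= p y) &
      (\int[mu]_y (p y)%:E = 1)%E].

(* Expectation of g(Y) when Y has density p with respect to mu. Since
   0 * +oo = 0, points where p vanishes do not contribute. *)
Definition Edens (mu : {measure set Y -> \bar R}) (p : Y -> R)
    (g : Y -> \bar R) : \bar R :=
  (\int[mu]_y (g y * (p y)%:E))%E.

(* In \bar R, a / 0 = +oo for a > 0 and 0 / 0 = 0, while lne 0 = -oo and
   lne +oo = +oo. Hence Edens mu p (log_ratio q1 q2) is finite only if both q1
   and q2 are positive almost everywhere for the probability with density p. *)
Definition dens_ratio (q1 q2 : Y -> R) (y : Y) : \bar R :=
  ((q1 y)%:E / (q2 y)%:E)%E.

Definition log_ratio (q1 q2 : Y -> R) (y : Y) : \bar R :=
  lne (dens_ratio q1 q2 y).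

End densities.

Definition real_continuous_on {R : realType} {T : topologicalType}
    (A : set T) (g : T -> \bar R) :=
  (forall z, A z -> g z \is a fin_num) /\
  {within A, continuous (fun z => fine (g z))}.

Definition mutually_independent {R : realType} {d d' : measure_display}
    {Omega : measurableType d} {Y : measurableType d'}
    (P : probability Omega R) (Ys : nat -> {RV P >-> Y}) :=
  forall (s : seq nat) (A : nat -> set Y),
    uniq s -> (forall i, measurable (A i)) ->
    P (\bigcap_(i in [set` s]) (Ys i @^-1` A i)) =
    (\prod_(i <- s) P (Ys i @^-1` A i))%E.

Section regression_functions.
Context {R : realType} {V : normedModType R} {X : set V}.

Definition sup_dist (th1 th2 : X -> R) : R :=
  sup (range (fun x => `|th1 x - th2 x|)).

(* kappa(x0, r): lower asymptotic frequency of visits of the covariate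
   sequence to the open r-ball about x0. *)
Definition visit_liminf (xs : nat -> X) (x0 : X) (r : R) : \bar R :=
  limn_einf (fun n : nat =>
    (n%:R^-1 * \sum_(i < n)
       \1_[set x : X | `|set_val x - set_val x0| < r] (xs i))%:E).

End regression_functions.

(* Functions X -> R with the Borel sigma-algebra of the topology of uniform
   convergence on X. *)
Definition unif_borel {R : realType} {V : normedModType R} (X : set V) :=
  g_sigma_algebraType (@open {uniform X -> R}).

Section posterior.
Context {R : realType} {V : normedModType R} {X : set V}.
Context {d : measure_display} {Y : measurableType d}.
Variables (f : R -> Y -> R) (Pi : probability (unif_borel X) R).
Variables (Theta : set (X -> R)) (thstar : X -> R) (xs : nat -> X).

(* Covariates and observations are indexed from 0: the first n pairs are used. *)
Definition lik_ratio (n : nat) (y : nat -> Y) (th : X -> R) : \bar R :=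
  (\prod_(i < n) dens_ratio (f (th (xs i))) (f (thstar (xs i))) (y i))%E.

Definition post (n : nat) (y : nat -> Y) (B : set (X -> R)) : \bar R :=
  ((\int[Pi]_(th in B) lik_ratio n y th) /
   (\int[Pi]_(th in Theta) lik_ratio n y th))%E.

End posterior.

(* Main.v *)
Require Import Defs.
From mathcomp Require Import all_boot all_order all_algebra.
From mathcomp Require Import all_classical all_reals all_analysis.
From mathcomp Require Import measurable_realfun lra ring.

Set Implicit Arguments.
Unset Strict Implicit.
Unset Printing Implicit Defensive.

Import Order.TTheory GRing.Theory Num.Theory.
Import numFieldNormedType.Exports.

Local Open Scope classical_set_scope.
Local Open Scope ring_scope.

(** Write N_n for the integral over a set of regression functions of the
    likelihood ratios prod_(i < n) f_(th x_i)(Y_i) / f_(th* x_i)(Y_i) against the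
    prior, and D_n for the same integral over the whole parameter set. The proof
    compares exponential rates: D_n decays more slowly than every exponential,
    while every th1 at positive distance from th* has a neighbourhood over which
    N_n decays exponentially fast. Compactness of the parameter set in the uniform
    topology then covers the far set by finitely many such neighbourhoods
    (posterior_far_set_cvg0). All almost sure statements come from bounds in mean
    by Markov's inequality and Borel-Cantelli (ae_exponential_bound). Means of
    products factor by independence (expectation_prod_indep), and the prior
    integral is exchanged with the expectation by Tonelli's theorem
    (integrated_ratio_bound).

    Near the diagonal, E_x[f_s / f_t] is close to 1, uniformly in x over the compact
    covariate space and for s, t close to th1(x) (ratio_mean_near_diag). Hence over
    a small uniform ball around th1 both the integral of prod f_th / f_th1 and that
    of prod f_th1 / f_th grow at an arbitrarily small exponential rate.

    Denominator (evidence_lower_bound). Over a small ball K around th*, which has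
    positive prior mass, Jensen's inequality bounds D_n below by Pi(K)^2 divided by
    the integral over K of the reciprocal ratios prod f_th* / f_th, whose mean is
    controlled as above.

    Numerator (local_likelihood_decay). Factor the ratio as
    prod f_th1 / f_th* times prod f_th / f_th1. The mean of the second factor is
    controlled as above. For the first (likelihood_decay), the difference quotients
    (E_x[(f_th1 / f_th* )^r] - 1) / r decrease to the mean log-ratio
    E_x[log (f_th1 / f_th* )] as r = 2^-k tends to 0 (power_mean_slope). By Dini's
    theorem the convergence is uniform in x, so some fixed power r satisfies
    E_x[(f_th1 / f_th* )^r] <= exp (r (E_x[log (f_th1 / f_th* )] + eta)) for all x
    (power_mean_le_drift). By identifiability the mean log-ratio is never positive,
    and it is at most -delta on a ball on which th1 stays away from th*. The
    covariates visit that ball with positive lower frequency, which makes the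
    r-th moment of the first factor exponentially small. *)

(** * Laws of transformed variables and products of independent factors *)

Section weighted_pushforward.
Local Open Scope ereal_scope.
Context d1 d2 (T : measurableType d1) (S : measurableType d2) (R : realType).
Variables (m : {measure set T -> \bar R}) (nu : {measure set S -> \bar R}).
Variables (phi : T -> S) (W : T -> \bar R).
Hypotheses (mphi : measurable_fun [set: T] phi) (mW : measurable_fun [set: T] W).
Hypothesis W0 : forall x, 0 <= W x.
Hypothesis nuE : forall A, measurable A ->
  \int[m]_(x in phi @^-1` A) W x = nu A.

Import HBNNSimple.

Let integral_weighted_nnsfun (h : {nnsfun S >-> R}) :
  \int[m]_x ((h (phi x))%:E * W x) = \int[nu]_y (h y)%:E.
Proof.
pose B r := h @^-1` [set r].
have mB r : measurable (B r) by exact: measurable_funPTI.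
have mphiB r : measurable (phi @^-1` B r).
  by rewrite -[X in measurable X]setTI; exact: mphi.
have step r : \int[m]_x ((\1_(B r) (phi x))%:E * W x) = nu (B r).
  rewrite -nuE// [RHS]integral_mkcond; apply: eq_integral => x _.
  rewrite patchE indicE /=.
  have -> : (x \in phi @^-1` B r) = (phi x \in B r) by apply/idP/idP; rewrite !inE.
  by case: ifP => _; rewrite ?mul1e ?mul0e.
have mstep r : measurable_fun [set: T] (fun x => (\1_(B r) (phi x))%:E * W x).
  apply: emeasurable_funM => //; apply/measurable_EFinP.
  by apply: measurableT_comp => //; exact: measurable_indic.
rewrite integralT_nnsfun sintegralE.
under eq_fsbigr do rewrite -step.
transitivity (\int[m]_x \sum_(r \in range h)
    (r%:E * ((\1_(B r) (phi x))%:E * W x))).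
  apply: eq_integral => x _; rewrite [in LHS]fimfunE -fsumEFin//.
  rewrite ge0_mule_fsuml.
    by apply: eq_fsbigr => r _; rewrite EFinM muleA.
  by move=> r; rewrite EFinM; exact: nnfun_muleindic_ge0.
rewrite ge0_integral_fsum//; last 2 first.
- by move=> r; apply: measurable_funeM.
- move=> r x _; rewrite muleA mule_ge0//.
  exact: nnfun_muleindic_ge0.
apply: eq_fsbigr => r; rewrite inE => -[y _ <-].
rewrite ge0_integralZl_EFin// => x _.
by rewrite mule_ge0// lee_fin indicE.
Qed.

(** Change of variables for a measure given through a weight: it serves both to
    integrate against the law of an observation through its density and to
    replace an event by a function in the independence relation. *)
Lemma integral_weighted_pushforward (g : S -> \bar R) :
  measurable_fun [set: S] g -> (forall y, 0 <= g y) ->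
  \int[m]_x (g (phi x) * W x) = \int[nu]_y g y.
Proof.
move=> mg g0; pose h := nnsfun_approx measurableT mg.
have hg y : (h n y)%:E @[n --> \oo] --> g y by exact: cvg_nnsfun_approx.
have nd_h y : nondecreasing_seq (fun n => (h n y)%:E).
  by move=> a b ab; rewrite lee_fin; exact/lefP/nd_nnsfun_approx.
transitivity (limn (fun n => \int[m]_x ((h n (phi x))%:E * W x))).
  rewrite -monotone_convergence//.
  - apply: eq_integral => x _; apply/esym/cvg_lim => //.
    (* continuity of the product can fail only at 0 * +oo, where the
       approximating products are already constant *)
    have [gW0|/neq0_mule_def gW] := eqVneq (g (phi x) * W x) 0; last first.
      by apply: (cvgeM gW (hg _)); exact: cvg_cst.
    rewrite gW0 [X in X @ _](_ : _ = cst 0); first exact: cvg_cst.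
    apply/funext => n /=; apply/eqP; rewrite mule_eq0.
    move/eqP: gW0; rewrite mule_eq0 => /orP[/eqP gx0|->]; last by rewrite orbT.
    have : (h n (phi x))%:E <= g (phi x).
      by rewrite /h nnsfun_approxE; exact: le_approx.
    by rewrite gx0 => hn; rewrite eq_le hn lee_fin fun_ge0.
  - move=> n; apply: emeasurable_funM => //; apply/measurable_EFinP.
    exact: measurableT_comp.
  - by move=> n x _; rewrite mule_ge0// lee_fin.
  - by move=> x _ a b ab; apply: lee_wpmul2r => //; exact: nd_h.
transitivity (limn (fun n => \int[nu]_y (h n y)%:E)).
  by apply: congr_lim; apply/funext => n; exact: integral_weighted_nnsfun.
rewrite -monotone_convergence//.
- by apply: eq_integral => y _; apply/cvg_lim => //; exact: hg.
- by move=> n; apply/measurable_EFinP.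
- by move=> n x _; rewrite lee_fin.
Qed.

End weighted_pushforward.

Lemma emeasurable_bigprod d (T : measurableType d) (R : realType) (D : set T) (I : Type)
    (s : seq I) (h : I -> T -> \bar R) :
  (forall i, measurable_fun D (h i)) ->
  measurable_fun D (fun x => \prod_(i <- s) h i x)%E.
Proof.
move=> mh; elim: s => [|i s IH].
  by under eq_fun do rewrite big_nil; exact: measurable_cst.
by under eq_fun do rewrite big_cons; exact: emeasurable_funM.
Qed.

Section independent_products.
Local Open Scope ereal_scope.
Context d d' (Omega : measurableType d') (Y : measurableType d) (R : realType).
Variables (P : probability Omega R) (Ys : nat -> {RV P >-> Y}).
Hypothesis hindep : mutually_independent Ys.
Variable g : nat -> Y -> \bar R.
Hypothesis mg : forall i, measurable_fun [set: Y] (g i).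
Hypothesis g0 : forall i y, 0 <= g i y.
Hypothesis gfin : forall i, \int[distribution P (Ys i)]_y g i y \is a fin_num.

Let measurable_prod (s : seq nat) :
  measurable_fun [set: Omega] (fun w => \prod_(i <- s) g i (Ys i w)).
Proof. by apply: emeasurable_bigprod => i; exact: measurableT_comp. Qed.

(** s1 lists the indices already carrying functions, s2 those still carrying
    events; the induction moves one index from s2 to s1. *)
Let expectation_prod_mixed (s1 s2 : seq nat) (A : nat -> set Y) :
  uniq (s1 ++ s2) -> (forall i, measurable (A i)) ->
  \int[P]_(w in \bigcap_(i in [set` s2]) (Ys i @^-1` A i))
     (\prod_(i <- s1) g i (Ys i w)) =
  (\prod_(i <- s1) \int[distribution P (Ys i)]_y g i y) *
  \prod_(i <- s2) P (Ys i @^-1` A i).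
Proof.
have mcap (s : seq nat) B : (forall i, measurable (B i)) ->
    measurable (\bigcap_(i in [set` s]) (Ys i @^-1` B i)).
  move=> mB; apply: fin_bigcap_measurable => [|i _]; first exact: finite_seq.
  exact: measurable_funPTI.
elim: s1 s2 A => [|j s1 IH] s2 A us mA.
  under eq_integral do rewrite big_nil.
  rewrite integral_cst; last exact: mcap.
  by rewrite big_nil !mul1e; apply: hindep.
set B := \bigcap_(i in _) _.
have mB : measurable B by exact: mcap.
pose c := (\prod_(i <- s1) \int[distribution P (Ys i)]_y g i y) *
          \prod_(i <- s2) P (Ys i @^-1` A i).
have c0 : 0 <= c.
  by rewrite mule_ge0// prode_ge0// => i _; apply: integral_ge0.
have cfin : c \is a fin_num.
  rewrite fin_numM//; apply: prode_fin_num => i _; first exact: gfin.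
  by apply: fin_num_measure; exact: measurable_funPTI.
have fc0 : (0 <= fine c)%R by exact: fine_ge0.
pose W w := ((fun w => \prod_(i <- s1) g i (Ys i w)) \_ B) w.
have mW : measurable_fun [set: Omega] W.
  apply/(measurable_restrictT _ mB).1.
  exact/measurable_funTS/measurable_prod.
have W0 w : 0 <= W w by rewrite erestrict_ge0// => ? _; rewrite prode_ge0.
have nuE C : measurable C -> \int[P]_(w in Ys j @^-1` C) W w =
    mscale (NngNum fc0) (distribution P (Ys j)) C.
  move=> mC.
  have mjC : measurable (Ys j @^-1` C).
    exact: measurable_funPTI.
  have uj : uniq (s1 ++ j :: s2) by rewrite -[j :: s2]cat1s uniq_catCA.
  have js2 : j \notin s2.
    by move: us => /=; rewrite mem_cat negb_or => /andP[/andP[]].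
  have [A' [A'j A'E mA']] : exists A' : nat -> set Y, [/\ A' j = C,
      {in s2, A' =1 A} & forall i, measurable (A' i)].
    exists (fun i => if i == j then C else A i); split=> [|i is2|i].
    - by rewrite eqxx.
    - by case: eqP => // ij; rewrite -ij is2 in js2.
    - by case: ifP.
  have := IH (j :: s2) A' uj mA'; rewrite big_cons.
  have -> : \bigcap_(i in [set` j :: s2]) (Ys i @^-1` A' i) =
            Ys j @^-1` C `&` B.
    apply/seteqP; split=> [w hw|w [jw Bw] i /=].
      split; first by have := hw j; rewrite /= mem_head A'j; exact.
      move=> i /= is2; suff : A' i (Ys i w). by rewrite A'E.
      by apply: (hw i); rewrite /= inE is2 orbT.
    rewrite inE => /predU1P[->|is2]; first by rewrite A'j.
    by rewrite A'E//; exact: Bw.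
  rewrite integral_mkcondr => ->.
  rewrite A'j /mscale/= fineK// /c.
  have -> : \prod_(i <- s2) P (Ys i @^-1` A' i) =
            \prod_(i <- s2) P (Ys i @^-1` A i).
    by apply: eq_big_seq => i is2; rewrite A'E.
  by rewrite (muleC (P _)) muleA.
have := integral_weighted_pushforward (measurable_funPT (Ys j)) mW W0 nuE.
move=> /(_ _ (mg j) (g0 j)).
rewrite ge0_integral_mscale//= fineK// => gW.
rewrite [in RHS]big_cons -muleA -/c muleC -gW.
rewrite integral_mkcond; apply: eq_integral => w _.
rewrite /W !patchE; case: ifP => _; last by rewrite mule0.
by rewrite big_cons.
Qed.

(** Independence is a product rule for events; the factors are turned from
    indicators into nonnegative functions one index at a time. *)
Lemma expectation_prod_indep (s : seq nat) : uniq s ->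
  \int[P]_w (\prod_(i <- s) g i (Ys i w)) =
  \prod_(i <- s) \int[distribution P (Ys i)]_y g i y.
Proof.
move=> us; have := @expectation_prod_mixed s [::] (fun=> setT).
rewrite cats0 big_nil mule1 => <-//.
by rewrite (_ : bigcap _ _ = setT)//; apply/seteqP; split.
Qed.

End independent_products.

(** * From bounds in mean to almost sure rates, and Tonelli's theorem *)

Section exponential_rates.
Local Open Scope ereal_scope.
Context d (T : measurableType d) (R : realType).

(** Markov's inequality makes the exceedance probabilities geometrically small,
    and Borel-Cantelli turns a bound in mean into one along almost every path. *)
Lemma ae_exponential_bound (m : {measure set T -> \bar R})
    (X : nat -> T -> \bar R) (C b c : R) :
  (forall n, measurable_fun [set: T] (X n)) -> (forall n x, 0 <= X n x) ->
  (0 <= C)%R -> (b < c)%R ->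
  (\forall n \near \oo, \int[m]_x X n x <= (C * expR (n%:R * b))%:E) ->
  {ae m, forall x, \forall n \near \oo, X n x <= (expR (n%:R * c))%:E}.
Proof.
move=> mX X0 C0 bc [N _ hN].
(* the mean bound is only available from rank N on *)
pose F n := if (n < N)%N then set0 else [set x | (expR (n%:R * c))%:E <= X n x].
have mF n : measurable (F n).
  rewrite /F; case: ifP => // _; rewrite -[X in measurable X]setTI.
  exact: emeasurable_fun_c_infty.
pose q := expR (b - c).
have q0 : (0 < q)%R by exact: expR_gt0.
have q1 : (`|q| < 1)%R by rewrite gtr0_norm// expR_lt1 subr_lt0.
have Fq n : m (F n) <= (geometric C q n)%:E.
  rewrite /F; case: ltnP => [_|Nn]; first by rewrite measure0 lee_fin geometric_ge0// ltW.
  have e0 : (0 < expR (n%:R * c))%R by exact: expR_gt0.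
  have := @le_integral_comp_abse _ _ _ m _ measurableT (X n) (expR (n%:R * c))
    id (@measurable_id _ _ _) (fun _ => id) (fun _ _ _ _ => id) (mX n) e0.
  rewrite setTI; under eq_set do rewrite gee0_abs//.
  under eq_integral do rewrite gee0_abs//.
  move=> /le_trans/(_ (hN _ Nn)).
  rewrite -lee_pdivlMl// -EFinM; congr (_ <= _%:E).
  by rewrite /geometric/= mulrCA -expRN -expRD /q -expRM_natl -mulr_natl mulrBr addrC.
have := @lim_sup_set_cvg0 _ _ _ m F mF.
have -> : \sum_(n <oo) m (F n) < +oo.
  apply: (@le_lt_trans _ _ (C * (1 - q)^-1)%:E); last exact: ltry.
  apply: lime_le; first exact: is_cvg_nneseries.
  apply: nearW => n; rewrite (le_trans (lee_sum _ (fun i _ => Fq i)))//.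
  by rewrite sumEFin lee_fin; exact: geometric_le_lim.
move=> /(_ isT) m0; exists (lim_sup_set F); split => //.
  apply: bigcap_measurable => // n _; exact: bigcup_measurable.
move=> x /=; apply: contra_notP => /= nF.
have /existsNP[k nFk] : ~ (forall n, (\bigcup_(j >= n) F j) x).
  by move=> h; apply: nF => n _.
exists (maxn k N) => // n /=; rewrite geq_max => /andP[kn Nn].
rewrite leNgt; apply/negP => Xn; apply: nFk; exists n => //=.
by rewrite /F ltnNge Nn /=; exact: ltW.
Qed.

End exponential_rates.

(** Tonelli's theorem for integrands that are controlled only when the first
    variable lies in W: the model densities are known only for parameters in
    [-M, M], hence only for regression functions in the parameter set. *)
Section restricted_tonelli.
Local Open Scope ereal_scope.
Context d1 d2 (T1 : measurableType d1) (T2 : measurableType d2) (R : realType).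
Variables (m1 : {sigma_finite_measure set T1 -> \bar R})
          (m2 : {sigma_finite_measure set T2 -> \bar R}).
Variables (W : set T1) (F : T1 * T2 -> \bar R).
Hypotheses (mW : measurable W) (mF : measurable_fun (W `*` [set: T2]) F).
Hypothesis F0 : forall x y, W x -> 0 <= F (x, y).

Let mWT : measurable (W `*` [set: T2]). Proof. exact: measurableX. Qed.

Let G := F \_ (W `*` [set: T2]).

Let mG : measurable_fun [set: T1 * T2] G.
Proof. have h := (measurable_restrictT F mWT).1 mF. exact h. Qed.

Let G0 z : 0 <= G z.
Proof. by apply: erestrict_ge0 => -[x y] [Wx _]; exact: F0. Qed.

Let GE x y : G (x, y) = ((fun x => F (x, y)) \_ W) x.
Proof.
rewrite /G !patchE.
by have -> : ((x, y) \in W `*` [set: T2]) = (x \in W)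
  by apply/idP/idP; rewrite !inE => //= -[].
Qed.

Let integralGE y : \int[m1]_(x in W) F (x, y) = \int[m1]_x G (x, y).
Proof. by rewrite integral_mkcond; apply: eq_integral => x _; rewrite GE. Qed.

Lemma measurable_fun_partial_integral :
  measurable_fun [set: T2] (fun y => \int[m1]_(x in W) F (x, y)).
Proof.
under eq_fun do rewrite integralGE.
exact: measurable_fun_fubini_tonelli_G.
Qed.

Lemma measurable_fun_partial_expectation :
  measurable_fun W (fun x => \int[m2]_y F (x, y)).
Proof.
apply: (@eq_measurable_fun _ _ _ _ W (fun x => \int[m2]_y G (x, y))).
  by move=> x xW; apply: eq_integral => y _; rewrite GE patchE xW.
exact/measurable_funTS/measurable_fun_fubini_tonelli_F.
Qed.

Lemma tonelli_restricted : \int[m2]_y \int[m1]_(x in W) F (x, y) =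
  \int[m1]_(x in W) \int[m2]_y F (x, y).
Proof.
under eq_integral do rewrite integralGE.
rewrite -fubini_tonelli// [RHS]integral_mkcond.
apply: eq_integral => x _; rewrite patchE; case: ifPn => xW.
  by apply: eq_integral => y _; rewrite GE patchE xW.
rewrite -[RHS](integral0 m2 setT); apply: eq_integral => y _.
by rewrite GE patchE (negbTE xW).
Qed.

End restricted_tonelli.

(** * Log-ratios and ratios of two densities *)

Section extended_ratio.
Local Open Scope ereal_scope.
Context (R : realType).

Lemma measurable_inv_EFin : measurable_fun [set: R] (fun x : R => x%:E^-1).
Proof.
(* the inverse as x / x ^ 2, which is right also at 0, reduces to a real power of
   a nonnegative number *)
have invE (x : R) : (x^-1 = x * (x ^+ 2) `^ (-1))%R.
  rewrite powR_inv1 ?sqr_ge0// expr2.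
  by have [->|x0] := eqVneq x 0%R; rewrite ?invr0 ?mul0r// invfM mulVKf.
under eq_fun do rewrite inver.
apply: measurable_fun_ifT => //.
  apply: (measurable_fun_bool true); rewrite setTI.
  by rewrite (_ : _ @^-1` _ = [set 0%R])//; apply/seteqP; split=> x /= /eqP.
apply/measurable_EFinP; rewrite (funext invE : GRing.inv = _).
apply: measurable_funM => //; apply: (measurableT_comp (measurable_powR (-1))).
exact: measurable_funX.
Qed.

Lemma measurable_dens_ratio d (T : measurableType d) (D : set T) (a b : T -> R) :
  measurable_fun D a -> measurable_fun D b -> measurable_fun D (dens_ratio a b).
Proof.
move=> ma mb; apply: emeasurable_funM; first exact/measurable_EFinP.
exact: (measurableT_comp measurable_inv_EFin).
Qed.

Lemma measurable_real_ratio d (T : measurableType d) (a b : T -> R) :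
  measurable_fun [set: T] a -> (forall y, (0 <= a y)%R) ->
  measurable_fun [set: T] b -> measurable_fun [set: T] (fun y => a y / b y)%R.
Proof.
move=> ma a0 mb.
have -> : (fun y => a y / b y)%R = fine \o dens_ratio a b.
  apply/funext => y /=; rewrite /dens_ratio inver.
  have [->|//] := eqVneq (b y) 0%R; rewrite invr0 mulr0.
  have [->|ay0] := eqVneq (a y) 0%R; first by rewrite mul0e.
  by rewrite gt0_muley// lte_fin lt_neqAle eq_sym ay0 a0.
by apply: measurableT_comp => //; exact: measurable_dens_ratio.
Qed.

Lemma dens_ratio_ge0 d (T : measurableType d) (a b : T -> R) y :
  (0 <= a y)%R -> (0 <= b y)%R -> 0 <= dens_ratio a b y.
Proof. by move=> a0 b0; rewrite mule_ge0 ?inve_ge0 ?lee_fin. Qed.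

Lemma dens_ratioE d (T : measurableType d) (a b : T -> R) y :
  (0 < b y)%R -> dens_ratio a b y = (a y / b y)%:E.
Proof. by move=> b0; rewrite /dens_ratio inver gt_eqF. Qed.

(** A zero of a takes precedence: 0 / 0 = 0 in the extended reals. *)
Lemma log_ratio_cases d (T : measurableType d) (a b : T -> R) y :
  (0 <= a y)%R -> (0 <= b y)%R ->
  log_ratio a b y = if a y == 0%R then -oo else
                    if b y == 0%R then +oo else (ln (a y / b y))%:E.
Proof.
rewrite /log_ratio /dens_ratio le0r => /predU1P[->|a0].
  by rewrite eqxx mul0e le0_lneNy.
rewrite le0r (gt_eqF a0) => /predU1P[->|b0].
  by rewrite eqxx inve0 gt0_muley// lte_fin.
by rewrite gt_eqF// inver gt_eqF// -EFinM lne_EFin// divr_gt0.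
Qed.

Lemma measurable_log_ratio d (T : measurableType d) (a b : T -> R) :
  measurable_fun [set: T] a -> (forall y, (0 <= a y)%R) ->
  measurable_fun [set: T] b -> (forall y, (0 <= b y)%R) ->
  measurable_fun [set: T] (log_ratio a b).
Proof.
move=> ma a0 mb b0.
rewrite (funext (fun y => log_ratio_cases (a0 y) (b0 y)) : log_ratio a b = _).
have m0 (c : T -> R) : measurable_fun [set: T] c ->
    measurable_fun [set: T] (fun y => c y == 0%R).
  move=> mc; apply: (measurable_fun_bool true).
  rewrite (_ : _ @^-1` _ = c @^-1` [set 0%R]); first exact: mc.
  by apply/seteqP; split=> x /= /eqP.
apply: measurable_fun_ifT => //; first exact: m0.
apply: measurable_fun_ifT => //; first exact: m0.
apply/measurable_EFinP/(measurableT_comp (@measurable_ln R)).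
exact: measurable_real_ratio.
Qed.

End extended_ratio.

Section density_pair.
Local Open Scope ereal_scope.
Context (R : realType) d (Y : measurableType d) (mu : {measure set Y -> \bar R}).
Variables p a b : Y -> R.
Hypothesis hp : is_density mu p.
Hypotheses (ma : measurable_fun [set: Y] a) (a0 : forall y, (0 <= a y)%R).
Hypotheses (mb : measurable_fun [set: Y] b) (b0 : forall y, (0 <= b y)%R).
Hypothesis hlog : Edens mu p (log_ratio a b) \is a fin_num.

Let rho y : R := (a y / b y)%R.

Let mp : measurable_fun [set: Y] p. Proof. by case: hp. Qed.
Let p0 y : (0 <= p y)%R. Proof. by case: hp. Qed.
Let rho0 y : (0 <= rho y)%R. Proof. exact: divr_ge0. Qed.

Let mrho : measurable_fun [set: Y] rho.
Proof.
exact: measurable_real_ratio.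
Qed.

(** The integral of a function is finite only if its positive and negative parts
    both have finite integrals. *)
Lemma integrable_log_ratio :
  mu.-integrable [set: Y] (fun y => log_ratio a b y * (p y)%:E).
Proof.
have mf : measurable_fun [set: Y] (fun y => log_ratio a b y * (p y)%:E).
  apply: emeasurable_funM; first exact: measurable_log_ratio.
  exact/measurable_EFinP.
apply/integrableP; split => //.
move: hlog; rewrite /Edens integralE fin_numB => /andP[fp fn].
rewrite -[X in \int[mu]_x X x]/(abse \o _) fune_abse ge0_integralD//.
- by rewrite lte_add_pinfty// ltey_eq ?fp ?fn.
- exact: measurable_funepos.
- exact: measurable_funeneg.
Qed.

(** A zero of either density makes the logarithm infinite, so a finite
    expected logarithm forbids zeros where the sampling density lives. *)
Lemma densities_pos_ae : {ae mu, forall y, (0 < p y -> 0 < a y /\ 0 < b y)%R}.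
Proof.
have := integrable_ae measurableT integrable_log_ratio.
apply: filterS => y /(_ I); rewrite log_ratio_cases// => fin py.
have [ay|ay] := eqVneq (a y) 0%R.
  by move: fin; rewrite ay eqxx gt0_mulNye// lte_fin.
have [by_|by_] := eqVneq (b y) 0%R.
  by move: fin; rewrite (negbTE ay) by_ eqxx gt0_mulye// lte_fin.
by split; rewrite lt_neqAle eq_sym ?ay ?by_ ?a0 ?b0.
Qed.

(** Almost everywhere for the sampling density the ratio is a positive real, so
    expectations of functions of it can be computed from real integrands. *)
Lemma Edens_realE (h : \bar R -> \bar R) (k : R -> R) :
  measurable_fun [set: Y] (h \o dens_ratio a b) -> measurable_fun [set: R] k ->
  (forall u, (0 < u)%R -> h u%:E = (k u)%:E) ->
  Edens mu p (h \o dens_ratio a b) = \int[mu]_y (k (rho y) * p y)%:E.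
Proof.
move=> mh mk hk; apply: ae_eq_integral => //.
- by apply: emeasurable_funM => //; exact/measurable_EFinP.
- apply/measurable_EFinP; apply: measurable_funM => //.
  exact: measurableT_comp.
apply: filterS densities_pos_ae => y ab _ /=.
have := p0 y; rewrite le0r => /predU1P[->|/ab[ay by_]]; first by rewrite mule0 mulr0.
by rewrite dens_ratioE// hk ?divr_gt0// EFinM.
Qed.

Lemma Edens_logE :
  Edens mu p (log_ratio a b) = \int[mu]_y (ln (rho y) * p y)%:E.
Proof.
apply: (@Edens_realE (@lne R) (@ln R)) => //; first exact: measurable_log_ratio.
by move=> u u0; rewrite lne_EFin.
Qed.

Lemma Edens_powE (r : R) :
  Edens mu p (fun y => poweR (dens_ratio a b y) r) =
  \int[mu]_y (rho y `^ r * p y)%:E.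
Proof.
apply: (@Edens_realE (fun x => poweR x r) (fun x => x `^ r)%R) => //.
apply: (measurableT_comp (measurable_poweR _)).
exact: measurable_dens_ratio.
Qed.

Lemma integrable_real_log : mu.-integrable [set: Y] (fun y => (ln (rho y) * p y)%:E).
Proof.
have mf : measurable_fun [set: Y] (fun y => (ln (rho y) * p y)%:E).
  by apply/measurable_EFinP; apply: measurable_funM => //; exact: measurableT_comp.
apply/integrableP; split => //.
have /integrableP[_] := integrable_log_ratio; apply: le_lt_trans.
rewrite le_eqVlt; apply/orP; left; apply/eqP.
apply: ae_eq_integral => //.
- exact: measurableT_comp.
- apply: measurableT_comp => //; apply: emeasurable_funM.
    exact: measurable_log_ratio.
  exact/measurable_EFinP.
apply: filterS densities_pos_ae => y ab _ /=.
have := p0 y; rewrite le0r => /predU1P[->|/ab[ay by_]]; first by rewrite mule0 mulr0.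
by rewrite log_ratio_cases// !gt_eqF.
Qed.

Lemma Edens_log_swap :
  Edens mu p (log_ratio b a) = - Edens mu p (log_ratio a b).
Proof.
have ilog := integrable_real_log.
rewrite Edens_logE -integralN; last exact: integrable_add_def.
apply: ae_eq_integral => //.
- apply: emeasurable_funM; last exact/measurable_EFinP.
  exact: measurable_log_ratio.
- by apply: measurableT_comp => //; exact: (measurable_int mu).
apply: filterS densities_pos_ae => y ab _ /=.
have := p0 y; rewrite le0r => /predU1P[->|/ab[ay by_]]; first by rewrite mule0 mulr0 oppr0.
rewrite log_ratio_cases// !gt_eqF// -EFinM -mulNr -lnV ?posrE ?divr_gt0//.
by rewrite /rho invf_div.
Qed.

End density_pair.

(** * Small powers and the logarithm *)

Section root_quotient.
Context (R : realType).

(** The difference quotient at 0, with step 2^-k, of the exponential function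
    a |-> u ^ a; halving the step makes it decrease to ln u. *)
Definition root_quotient (k : nat) (u : R) : R :=
  2 ^+ k * (u `^ (2^-1 ^+ k) - 1).

(** With v the 2^-(k+1)-th power of u, this is 2 (v - 1) <= v ^ 2 - 1. *)
Lemma root_quotient_decr k (u : R) : 0 <= u ->
  root_quotient k.+1 u <= root_quotient k u.
Proof.
move=> u0; rewrite /root_quotient; set v := u `^ (2^-1 ^+ k.+1).
have -> : u `^ (2^-1 ^+ k) = v ^+ 2.
  rewrite -powR_mulrn ?powR_ge0// /v -powRrM; congr (_ `^ _).
  by rewrite exprSr -mulrA mulVf ?mulr1.
rewrite exprSr -mulrA ler_pM2l ?exprn_gt0//.
by have := sqr_ge0 (v - 1); nra.
Qed.

Lemma root_quotient_le k (u : R) : 0 <= u -> root_quotient k u <= u - 1.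
Proof.
move=> u0; elim: k => [|k IH].
  by rewrite /root_quotient !expr0 mul1r powRr1.
exact: (le_trans (root_quotient_decr k u0) IH).
Qed.

Lemma ln_le_root_quotient k (u : R) : 0 < u -> ln u <= root_quotient k u.
Proof.
move=> u0; rewrite /root_quotient -{2}(lnK u0) -expRM.
set h := ln u * _; have {1}-> : ln u = 2 ^+ k * h.
  by rewrite /h mulrCA exprVn mulfV ?mulr1// expf_neq0.
by rewrite ler_pM2l ?exprn_gt0//; have := expR_ge1Dx h; lra.
Qed.

(** From 1 - h <= exp (- h), multiplied by exp h. *)
Lemma root_quotient_le_ln k (u : R) : 0 < u ->
  root_quotient k u <= ln u * u `^ (2^-1 ^+ k).
Proof.
move=> u0; rewrite /root_quotient -{1 3}(lnK u0) -expRM; set h := ln u * _.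
have := expR_ge1Dx (- h); rewrite -(@ler_pM2l _ (expR h)) ?expR_gt0//.
rewrite expRN mulfV ?gt_eqF ?expR_gt0// => hh.
have {1}-> : ln u = 2 ^+ k * h.
  by rewrite /h mulrCA exprVn mulfV ?mulr1// expf_neq0.
rewrite -mulrA ler_pM2l ?exprn_gt0//; lra.
Qed.

Lemma cvg_root_quotient (u : R) : 0 < u ->
  root_quotient k u @[k --> \oo] --> ln u.
Proof.
move=> u0; apply: (@squeeze_cvgr _ _ _ _ (cst (ln u)) (fun k => ln u * u `^ (2^-1 ^+ k))).
- apply: nearW => k.
  by rewrite ln_le_root_quotient//= root_quotient_le_ln.
- exact: cvg_cst.
- rewrite -[X in _ --> X]mulr1; apply: cvgM; first exact: cvg_cst.
  rewrite [X in _ --> X](_ : 1 = expR (0 * ln u)); last by rewrite mul0r expR0.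
  have -> : (fun k => u `^ (2^-1 ^+ k)) = (fun k => expR (2^-1 ^+ k * ln u)).
    by apply/funext => k; rewrite /powR gt_eqF.
  apply: continuous_cvg; first exact: continuous_expR.
  apply: cvgM; last exact: cvg_cst.
  apply: cvg_expr; rewrite ger0_norm ?invr_ge0// invf_lt1 ?ltr1n//.
Qed.

Lemma root_quotient_norm_le k (u : R) : 0 < u ->
  `|root_quotient k u| <= `|u - 1| + `|ln u|.
Proof.
move=> u0; have h1 := ln_le_root_quotient k u0.
have h2 := root_quotient_le k (ltW u0).
have h3 := ler_norm (u - 1); have h4 := ler_norm (- ln u).
have h5 := normr_ge0 (u - 1); have h6 := normr_ge0 (ln u).
by rewrite normrN in h4; rewrite ler_norml; apply/andP; split; lra.
Qed.

End root_quotient.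

Section power_moments.
Local Open Scope ereal_scope.
Context (R : realType) d (Y : measurableType d) (mu : {measure set Y -> \bar R}).
Variables p rho : Y -> R.
Hypothesis hp : is_density mu p.
Hypotheses (mrho : measurable_fun [set: Y] rho) (rho0 : forall y, (0 <= rho y)%R).
Hypothesis rho_pos : {ae mu, forall y, (0 < p y -> 0 < rho y)%R}.
Hypothesis ilog : mu.-integrable [set: Y] (fun y => (ln (rho y) * p y)%:E).

Let moment (r : R) := \int[mu]_y (rho y `^ r * p y)%:E.
Hypothesis moment_fin : forall r : R, r \in `[0%R, 1%R] -> moment r \is a fin_num.

Let mp : measurable_fun [set: Y] p. Proof. by case: hp. Qed.
Let p0 y : (0 <= p y)%R. Proof. by case: hp. Qed.

Let step_itv k : ((2^-1 : R) ^+ k)%R \in `[0%R, 1%R].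
Proof.
rewrite in_itv/= exprn_ge0 ?invr_ge0//= exprn_ile1 ?invr_ge0//.
by rewrite invf_le1 ?ler1n.
Qed.

Let integrable_p : mu.-integrable [set: Y] (fun y => (p y)%:E).
Proof.
apply/integrableP; split; first exact/measurable_EFinP.
under eq_integral do rewrite gee0_abs ?lee_fin//.
by case: hp => _ _ ->; rewrite ltry.
Qed.

Let integrable_moment (r : R) : r \in `[0%R, 1%R] ->
  mu.-integrable [set: Y] (fun y => (rho y `^ r * p y)%:E).
Proof.
move=> r01; apply/integrableP; split.
  apply/measurable_EFinP; apply: measurable_funM => //.
  exact: (measurableT_comp (measurable_powR r)).
under eq_integral do rewrite gee0_abs ?lee_fin ?mulr_ge0 ?powR_ge0//.
by rewrite ltey_eq moment_fin.
Qed.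

Let quotientE k : (fun y => (root_quotient k (rho y) * p y)%:E) =
  (fun y => (2 ^+ k)%:E * ((rho y `^ (2^-1 ^+ k) * p y)%:E - (p y)%:E)).
Proof.
by apply/funext => y; rewrite -EFinB -EFinM /root_quotient -mulrA mulrBl mul1r.
Qed.

Let integrable_quotient k :
  mu.-integrable [set: Y] (fun y => (root_quotient k (rho y) * p y)%:E).
Proof.
rewrite quotientE; apply: integrableZl => //; apply: integrableB => //.
exact: integrable_moment.
Qed.

Let integral_quotient k : \int[mu]_y (root_quotient k (rho y) * p y)%:E =
  (2 ^+ k * (fine (moment (2^-1 ^+ k)) - 1))%:E.
Proof.
rewrite quotientE integralZl//; last by apply: integrableB => //; exact: integrable_moment.
rewrite integralB//; last exact: integrable_moment.
have -> : \int[mu]_y (p y)%:E = 1 by case: hp.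
by rewrite -[X in _ * (X - _)]fineK ?moment_fin.
Qed.

Lemma moment_quotient_decr k :
  (2 ^+ k.+1 * (fine (moment (2^-1 ^+ k.+1)) - 1) <=
   2 ^+ k * (fine (moment (2^-1 ^+ k)) - 1))%R.
Proof.
rewrite -lee_fin -!integral_quotient; apply: le_integral => // y _.
by rewrite lee_fin ler_wpM2r// root_quotient_decr.
Qed.

(** Dominated convergence: the quotients lie between ln u and u - 1. *)
Lemma moment_quotient_cvg :
  (2 ^+ k * (fine (moment (2^-1 ^+ k)) - 1))%:E @[k --> \oo] -->
  \int[mu]_y (ln (rho y) * p y)%:E.
Proof.
rewrite (funext (fun k => esym (integral_quotient k)) : (fun k => _%:E) = _).
pose g y := (`|rho y * p y - p y| + `|ln (rho y) * p y|)%R%:E.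
have ig : mu.-integrable [set: Y] g.
  apply: (@integrableD _ _ _ _ _ _ (fun y => (`|rho y * p y - p y|)%R%:E)
    (fun y => (`|ln (rho y) * p y|)%R%:E)) => //.
    apply: (@integrable_norm _ _ _ mu setT (fun y => (rho y * p y - p y)%R)).
    apply: (@integrableB _ _ _ _ _ measurableT (fun y => (rho y * p y)%:E)
      (fun y => (p y)%:E)) => //.
    have := @integrable_moment 1%R; rewrite in_itv/= ler01 lexx => /(_ isT).
    by apply: eq_integrable => // y _; rewrite powRr1.
  exact: (@integrable_norm _ _ _ mu setT (fun y => (ln (rho y) * p y)%R)).
have [|||||_ _] // := @dominated_convergence _ _ _ mu _ measurableT
  (fun k y => (root_quotient k (rho y) * p y)%:E)
  (fun y => (ln (rho y) * p y)%:E) g.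
- by move=> k; exact: (measurable_int mu).
- exact: (measurable_int mu).
- apply: filterS rho_pos => y rp _.
  have := p0 y; rewrite le0r => /predU1P[->|/rp ry].
    by rewrite mulr0; under eq_fun do rewrite mulr0; exact: cvg_cst.
  apply: cvg_EFin; first by apply: nearW.
  by apply: cvgM; [exact: cvg_root_quotient|exact: cvg_cst].
- apply: filterS rho_pos => y rp k _; rewrite /g lee_fin.
  have := p0 y; rewrite le0r => /predU1P[->|/[dup] py /rp ry].
    by rewrite !mulr0 subr0 normr0 addr0.
  have := root_quotient_norm_le k ry; move: (root_quotient _ _) => q hq.
  by rewrite -[X in `|_ - X|%R]mul1r -mulrBl !normrM -mulrDl ler_wpM2r.
Qed.

End power_moments.

(** * Uniformity over a compact space *)

Section compact_uniformity.
Context {R : realType}.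

Lemma compact_set_type {T : topologicalType} (X : set T) :
  compact X -> compact [set: X].
Proof.
move=> cX F PF _.
have PG : ProperFilter (set_val @ F) by exact: fmap_proper_filter.
have GX : (set_val @ F) X 
  by apply: (@filterS _ F _ setT); [move=> x _; exact: set_valP|exact: filterT].
have [x [Xx clx]] := cX _ PG GX.
exists (SigSub (mem_set Xx)); split => // A B FA [_ [[/= W oW <-] /= Wx WB]].
have GA : (set_val @ F) (set_val @` A).
  by apply: (@filterS _ F _ A) => // y Ay; exists y.
have [_ [[y Ay <-] Wy]] := clx _ W GA (open_nbhs_nbhs (conj oW Wx)).
by exists y; split => //; exact: WB.
Qed.

(** Dini's theorem, in the one-sided form: each point has a neighbourhood on
    which some term, hence every later one, is below L + e. *)
Lemma dini_upper {T : topologicalType} (G : nat -> T -> R) (L : T -> R) :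
  compact [set: T] -> (forall k, continuous (G k)) -> continuous L ->
  (forall k x, G k.+1 x <= G k x) -> (forall x, G k x @[k --> \oo] --> L x) ->
  forall e, 0 < e -> exists k, forall x, G k x < L x + e.
Proof.
move=> cT cG cL decr GL e e0.
have decr_le x : nonincreasing_seq (G ^~ x) by exact/nonincreasing_seqP.
have /(_ _ \oo (fun k x => G k x < L x + e)) := (compact_near_coveringP _).1 cT.
case=> [x _|k _ hk]; last by exists k => x; exact: (hk k (leqnn k)).
have e40 : 0 < e / 4 by rewrite divr_gt0.
have /cvgrPdist_lt/(_ _ e40)[k0 _ hk0] := GL x.
have /cvgrPdist_lt/(_ _ e40) hG := cG k0 x.
have /cvgrPdist_lt/(_ _ e40) hL := cL x.
exists ([set x' | `|G k0 x - G k0 x'| < e / 4 /\ `|L x - L x'| < e / 4],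
        [set k | (k0 <= k)%N]); first split.
- by apply: filterI; [exact: hG | exact: hL].
- by exists k0.
- move=> [x' k] /= [[h1 h2] k0k].
  have := hk0 _ (leqnn k0); have := decr_le x' _ _ k0k.
  move: h1 h2; rewrite /= !ltr_norml => /andP[? ?] /andP[? ?] ? /andP[? ?]; lra.
Qed.

Let near_graph {T : topologicalType} (A : set (T * R * R))
    (g : T * R * R -> R) (a b : T -> R) :
  {within A, continuous g} -> continuous a -> continuous b ->
  (forall x, A (x, a x, b x)) ->
  forall x0 e, 0 < e -> \forall x \near x0 & r \near 0^'+,
    forall s t, A (x, s, t) -> `|a x - s| < r -> `|b x - t| < r ->
    `|g (x0, a x0, b x0) - g (x, s, t)| < e.
Proof.
move=> /subspace_continuousP cg ca cb Aab x0 e e0.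
have /cvgrPdist_lt/(_ _ e0) := cg _ (Aab x0).
move=> [[U T2] /= [[[U1 S] /= [U1x Sa] sU] Tb] sUT].
move: Sa Tb => /nbhs_ballP[r1 /= r10 r1S] /nbhs_ballP[r2 /= r20 r2T].
pose r := Num.min r1 r2 / 2.
have r0 : 0 < r by rewrite divr_gt0// lt_min r10 r20.
have [rr1 rr2] : r + r <= r1 /\ r + r <= r2.
  by rewrite /r -splitr !ge_min !lexx orbT.
have /cvgrPdist_lt/(_ _ r0) ha := ca x0.
have /cvgrPdist_lt/(_ _ r0) hb := cb x0.
exists (U1 `&` [set x | `|a x0 - a x| < r /\ `|b x0 - b x| < r],
        [set r' | r' < r]); first split => /=.
- by apply: filterI => //; apply: filterI; [exact: ha|exact: hb].
- exact: nbhs_right_lt.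
move=> [x r'] /= [[Ux [hax hbx]] r'r] s t Axst sa tb.
have close u0 u v r3 : r + r <= r3 -> `|u0 - u| < r -> `|u - v| < r' ->
    ball (u0 : R) r3 v.
  move=> rr3 h1 h2; rewrite -ball_normE /=.
  have := ler_distD u u0 v; lra.
apply: (sUT (x, s, t)) => //=; split; last exact/r2T/(close _ (b x)).
by apply: (sU (x, s)); split => //=; exact/r1S/(close _ (a x)).
Qed.

Lemma continuous_along_graph {T : topologicalType} (A : set (T * R * R))
    (g : T * R * R -> R) (a b : T -> R) :
  {within A, continuous g} -> continuous a -> continuous b ->
  (forall x, A (x, a x, b x)) -> continuous (fun x => g (x, a x, b x)).
Proof.
move=> cg ca cb Aab x; apply/cvgrPdist_lt => e e0.
have [[U V] /= [Ux [r /= r0 rV]] UV] := near_graph cg ca cb Aab x e0.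
apply: filterS Ux => y Uy.
have Vr : V (r / 2).
  apply: rV; last by rewrite /= divr_gt0.
  by rewrite /= sub0r normrN gtr0_norm ?divr_gt0// ltr_pdivrMr// ltr_pMr// ltr1n.
by apply: (UV (y, r / 2)) => //=; rewrite subrr normr0 divr_gt0.
Qed.

(** The graph of (a, b) is compact, so continuity at its points holds with a
    common radius. *)
Lemma uniform_near_graph {T : topologicalType} (A : set (T * R * R))
    (g : T * R * R -> R) (a b : T -> R) :
  compact [set: T] -> {within A, continuous g} ->
  continuous a -> continuous b -> (forall x, A (x, a x, b x)) ->
  forall e, 0 < e -> exists2 r, 0 < r & forall x s t, A (x, s, t) ->
    `|a x - s| < r -> `|b x - t| < r -> `|g (x, a x, b x) - g (x, s, t)| < e.
Proof.
move=> cT cg ca cb Aab e e0.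
pose Q r x := forall s t, A (x, s, t) ->
    `|a x - s| < r -> `|b x - t| < r -> `|g (x, a x, b x) - g (x, s, t)| < e.
have /(_ _ (0^'+ : set_system R) Q) := (compact_near_coveringP _).1 cT.
case=> [x0 _|r /= r0 hr].
  have e20 : 0 < e / 2 by rewrite divr_gt0.
  have [[U V] /= [Ux Vr] UV] := near_graph cg ca cb Aab x0 e20.
  exists (U, V `&` [set r | 0 < r]); first split => //=.
    by apply: filterI => //; exact: nbhs_right_gt.
  move=> [x r] /= [Ux' [Vr' r0]] s t Axst sa tb.
  have h1 := UV (x, r) (conj Ux' Vr') _ _ Axst sa tb.
  have := UV (x, r) (conj Ux' Vr') _ _ (Aab x).
  rewrite /= !subrr normr0 distrC => /(_ r0 r0) h2.
  have := ler_distD (g (x0, a x0, b x0)) (g (x, a x, b x)) (g (x, s, t)).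
  move: h1 h2 => /= h1 h2; lra.
exists (r / 2); first by rewrite divr_gt0.
have rhalf : ball_ Num.norm 0 r (r / 2).
  by rewrite /= sub0r normrN gtr0_norm ?divr_gt0// ltr_pdivrMr// ltr_pMr// ltr1n.
have r20 : 0 < r / 2 by rewrite divr_gt0.
by move=> x; exact: (hr (r / 2) rhalf r20 x I).
Qed.

End compact_uniformity.

(** * Functions under uniform convergence *)

Section uniform_function_space.
Context {R : realType} {V : normedModType R} (X : set V).
Implicit Types (th : X -> R).

Lemma uniform_nbhs_ball th (r : R) : 0 < r ->
  nbhs (th : {uniform X -> R}) [set th' | forall x, `|th x - th' x| < r].
Proof.
move=> r0; apply/uniform_nbhs.
exists [set xy | `|xy.1 - xy.2| < r]; split; last by move=> h hh x; exact: hh.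
by rewrite -entourage_ballE; exists r => //= -[u v]; rewrite /= -ball_normE.
Qed.

Lemma eval_continuous (x : X) :
  continuous ((fun th => th x) : {uniform X -> R} -> R).
Proof.
have FF (th : {uniform X -> R}) : Filter (nbhs th) by exact: nbhs_filter.
move=> th; apply/(@cvgrPdist_lt _ _ _ _ (FF th)) => e e0.
by apply: (@filterS _ _ (FF th) _ _ _
  (uniform_nbhs_ball th e0)) => h; exact.
Qed.

Lemma measurable_eval (x : X) :
  measurable_fun [set: unif_borel X] (fun th : unif_borel X => th x : R).
Proof.
apply: (@measurability _ _ _ _ _ _ (@RGenOpens.G R)).
  exact: RGenOpens.measurableE.
move=> _ [_ [a [b ->] <-]]; rewrite setTI.
apply: sub_sigma_algebra.
by apply: open_comp => [th _|]; [exact: eval_continuous|exact: interval_open].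
Qed.

(** Evaluations are continuous and separate functions. *)
Lemma uniform_fun_hausdorff : hausdorff_space {uniform X -> R}.
Proof.
move=> p q pq; apply/funext => x; apply: Rhausdorff => A B pA qB.
have [h [hA hB]] := pq _ _ (eval_continuous pA) (eval_continuous qB).
by exists (h x).
Qed.

Lemma uniform_compact_measurable (Theta : set (X -> R)) :
  compact (Theta : set {uniform X -> R}) ->
  measurable (Theta : set (unif_borel X)).
Proof.
move=> /(compact_closed uniform_fun_hausdorff) cT.
rewrite -(setCK Theta); apply: measurableC; apply: sub_sigma_algebra.
exact: closed_openC.
Qed.

Lemma gt_dist_ball (a b : X -> R) (x0 : X) (eps : R) :
  continuous a -> continuous b -> eps < `|a x0 - b x0| ->
  exists2 r, 0 < r & forall x : X, `|set_val x - set_val x0| < r ->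
    eps < `|a x - b x|.
Proof.
move=> ca cb far.
have cd : (fun x => `|a x - b x|) x @[x --> x0] --> `|a x0 - b x0|.
  apply: (@cvg_norm _ _ _ (nbhs x0) _ (fun x => a x - b x)).
  by apply: cvgB; [exact: ca|exact: cb].
have : nbhs x0 [set x | eps < `|a x - b x|] := cvgr_gt _ cd _ far.
move=> [_ [[/= W oW <-] /= Wx sW]].
have /nbhs_ballP[r /= r0 rW] := open_nbhs_nbhs (conj oW Wx).
exists r => // x xr; apply: sW => /=; apply: rW.
by rewrite -ball_normE /= distrC.
Qed.

Lemma lt_sup_distP (a b : X -> R) (C eps : R) (x0 : X) :
  (forall x, `|a x - b x| <= C) ->
  eps < sup_dist a b <-> exists x, eps < `|a x - b x|.
Proof.
move=> abC; split=> [|[x far]].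
  move=> /sup_gt[|_ [x _ <-] far]; last by exists x.
  by exists `|a x0 - b x0|; exists x0.
apply: (lt_le_trans far); apply: ub_le_sup; last by exists x.
by exists C => _ [y _ <-].
Qed.

Lemma open_far_from (b : X -> R) (eps : R) :
  open ([set a | exists x, eps < `|a x - b x|] : set {uniform X -> R}).
Proof.
rewrite (_ : [set a | _] = \bigcup_(x : X) [set a : {uniform X -> R} |
  eps < `|a x - b x|]); last first.
  by apply/seteqP; split=> [a [x ax]|a [x _ ax]]; exists x.
apply: bigcup_open => x _.
have cd : continuous ((fun a => `|a x - b x|) : {uniform X -> R} -> R).
  move=> a; apply: (@cvg_norm _ _ _ (nbhs (a : {uniform X -> R})) _
    (fun a => a x - b x)).
  apply: (@cvgB _ _ _ (nbhs (a : {uniform X -> R})) _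
    (fun a => a x) (fun=> b x)); last exact: cvg_cst.
  exact: eval_continuous.
apply: (@open_comp {uniform X -> R} R (fun a => `|a x - b x|)
  [set y | eps < y]) => [a _|]; [exact: cd|exact: open_gt].
Qed.

End uniform_function_space.

(** * Jensen's inequality for reciprocals *)

Section reciprocal_mean.
Local Open Scope ereal_scope.
Context d (T : measurableType d) (R : realType).

(** The graph of r |-> 1/r lies above its tangent line at 1/a. *)
Lemma inve_tangent (r : \bar R) (a : R) : 0 <= r -> (0 < a)%R ->
  (2 * a)%:E <= r^-1 + (a ^+ 2)%:E * r.
Proof.
move=> r0 a0; case: r r0 => [r| |] // r0.
  move: r0; rewrite lee_fin le0r => /predU1P[->|r0].
    by rewrite inve0 mule0 adde0 leey.
  rewrite inver gt_eqF// -EFinM -EFinD lee_fin.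
  have -> : (r^-1 + a ^+ 2 * r = (1 - a * r) ^+ 2 / r + 2 * a)%R.
    by field; rewrite gt_eqF.
  by rewrite lerDr divr_ge0 ?sqr_ge0// ltW.
by rewrite invey add0e gt0_muley ?leey// lte_fin exprn_gt0.
Qed.

(** Jensen's inequality for the reciprocal. Integrating the tangent line at 1/a
    avoids dividing by an integral that may be infinite; a = B / k makes the
    bound sharp. *)
Lemma integral_ge_inv (m : {measure set T -> \bar R}) (K : set T)
    (r : T -> \bar R) (k B : R) :
  measurable K -> measurable_fun K r ->
  measurable_fun K (fun x => (r x)^-1) ->
  (forall x, K x -> 0 <= r x) -> m K = k%:E -> (0 < k)%R -> (0 < B)%R ->
  \int[m]_(x in K) (r x)^-1 <= B%:E ->
  (k ^+ 2 / B)%:E <= \int[m]_(x in K) r x.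
Proof.
move=> mK mr mrV r0 mk k0 B0 hB.
pose a := (B / k)%R; have a0 : (0 < a)%R by rewrite divr_gt0.
have I0 : 0 <= \int[m]_(x in K) r x by exact: integral_ge0.
have : \int[m]_(x in K) (2 * a)%:E <=
    \int[m]_(x in K) ((r x)^-1 + (a ^+ 2)%:E * r x).
  apply: ge0_le_integral => //.
  - by move=> x Kx; rewrite lee_fin mulr_ge0// ltW.
  - by apply: emeasurable_funD => //; exact: measurable_funeM.
  - by move=> x Kx; exact: inve_tangent (r0 _ Kx) a0.
rewrite integral_cst// ge0_integralD//; last 3 first.
- by move=> x Kx; rewrite inve_ge0 r0.
- by move=> x Kx; rewrite mule_ge0 ?r0// lee_fin sqr_ge0.
- exact: measurable_funeM.
rewrite ge0_integralZl_EFin ?sqr_ge0// mk.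
move=> /le_trans/(_ (leeD2r _ hB)).
case: (\int[m]_(x in K) r x) I0 => [I| |] // I0; last by rewrite leey.
rewrite -!EFinM -EFinD !lee_fin => h.
have aE : (a * k = B)%R by rewrite /a divfK// gt_eqF.
rewrite ler_pdivrMr// -(@ler_pM2l _ (a ^+ 2))// ?exprn_gt0//.
have -> : (a ^+ 2 * k ^+ 2 = B ^+ 2)%R by rewrite -exprMn aE.
rewrite mulrA [leRHS]mulrC expr2 ler_pM2l//.
by move: h; rewrite -mulrA aE; lra.
Qed.

(** Vanishing factors are harmless: their inverse is +oo, which absorbs the
    other inverses because none of them is 0. *)
Lemma inve_prod (s : seq nat) (u : nat -> R) :
  (forall i, (0 <= u i)%R) ->
  (\prod_(i <- s) (u i)%:E)^-1 = \prod_(i <- s) (u i)%:E^-1.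
Proof.
move=> u0; elim: s => [|i s IH]; first by rewrite !big_nil inve1.
rewrite !big_cons -IH prodEFin -EFinM.
have : (0 <= \prod_(j <- s) u j)%R by exact: prodr_ge0.
move: (\prod_(j <- s) u j)%R => v; have := u0 i.
rewrite !le0r => /predU1P[->|ui0] /predU1P[->|v0].
- by rewrite mulr0 inve0 mulyy.
- by rewrite mul0r inve0 inver gt_eqF// gt0_mulye// lte_fin invr_gt0.
- by rewrite mulr0 inve0 inver gt_eqF// gt0_muley// lte_fin invr_gt0.
- by rewrite !inver !gt_eqF ?mulr_gt0// -EFinM invfM.
Qed.

End reciprocal_mean.

(** * Moments of likelihood ratios, uniformly over the covariates *)

Section density_moments.
Local Open Scope ereal_scope.
Context (R : realType) d (Y : measurableType d) (mu : {measure set Y -> \bar R}).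
Variables p a b : Y -> R.
Hypothesis hp : is_density mu p.
Hypotheses (ma : measurable_fun [set: Y] a) (a0 : forall y, (0 <= a y)%R).
Hypotheses (mb : measurable_fun [set: Y] b) (b0 : forall y, (0 <= b y)%R).

Lemma Edens_ratio_self : Edens mu p (log_ratio a a) \is a fin_num ->
  Edens mu p (dens_ratio a a) = 1.
Proof.
move=> hlog; have [mp p0 <-] := hp.
apply: ae_eq_integral => //.
- apply: emeasurable_funM; first exact: measurable_dens_ratio.
  exact/measurable_EFinP.
- exact/measurable_EFinP.
apply: filterS (densities_pos_ae hp ma a0 ma a0 hlog) => y ay _ /=.
have := p0 y; rewrite le0r => /predU1P[->|/ay[{}ay _]]; first by rewrite mule0.
by rewrite dens_ratioE// divff ?gt_eqF// mul1e.
Qed.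

Let power_mean (r : R) := Edens mu p (fun y => poweR (dens_ratio a b y) r).

(** r |-> E[(a/b)^r] takes the value 1 at 0 and has slope E[log (a/b)] there; the
    difference quotients are taken along r = 2^-k so that they decrease. *)
Lemma power_mean_slope :
  Edens mu p (log_ratio a b) \is a fin_num ->
  (forall r : R, r \in `[0%R, 1%R] -> power_mean r \is a fin_num) ->
  let G k := (2 ^+ k * (fine (power_mean (2^-1 ^+ k)) - 1))%R in
  (forall k, (G k.+1 <= G k)%R) /\
  (G k @[k --> \oo] --> fine (Edens mu p (log_ratio a b))).
Proof.
move=> hlog hpow G.
have rho0 y : (0 <= a y / b y)%R by exact: divr_ge0.
have mrho := measurable_real_ratio ma a0 mb.
have rho_pos : {ae mu, forall y, (0 < p y -> 0 < a y / b y)%R}.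
  apply: filterS (densities_pos_ae hp ma a0 mb b0 hlog) => y h /h[? ?].
  exact: divr_gt0.
have ilog := integrable_real_log hp ma a0 mb b0 hlog.
have powE r := Edens_powE hp ma a0 mb b0 hlog r.
have fin r : r \in `[0%R, 1%R] ->
    \int[mu]_y ((a y / b y) `^ r * p y)%:E \is a fin_num.
  by move=> /hpow; rewrite /power_mean powE.
have GE k : G k = (2 ^+ k * (fine (\int[mu]_y
    ((a y / b y) `^ (2^-1 ^+ k) * p y)%:E) - 1))%R by rewrite /G /power_mean powE.
split=> [k|].
  by rewrite !GE; exact: (moment_quotient_decr hp mrho rho0 fin).
have := moment_quotient_cvg hp mrho rho0 rho_pos ilog fin.
rewrite -Edens_logE// -[X in _ --> X]fineK// => /fine_cvgP[_].
by under [X in _ -> X @ _ --> _]eq_fun do rewrite GE.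
Qed.

End density_moments.

Section regression_model.
Local Open Scope ereal_scope.
Context (R : realType) (V : normedModType R) (X : set V)
  (d d' : measure_display) (Y : measurableType d) (Omega : measurableType d')
  (mu : {measure set Y -> \bar R}).
Variables (M : R) (p0 : X -> Y -> R) (f : R -> Y -> R).
Hypothesis hp0 : forall x, is_density mu (p0 x).
Hypothesis hf : forall t, t \in `[(- M)%R, M] -> is_density mu (f t).

Let box := [set z : X * R * R |
  z.1.2 \in `[(- M)%R, M] /\ z.2 \in `[(- M)%R, M]].

Hypothesis hlogcont : real_continuous_on box
  (fun z => Edens mu (p0 z.1.1) (log_ratio (f z.1.2) (f z.2))).
Hypothesis hpowcont : forall r : R, r \in `[0%R, 1%R] -> real_continuous_on box
  (fun z => Edens mu (p0 z.1.1)
     (fun y => poweR (dens_ratio (f z.1.2) (f z.2) y) r)).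
Hypothesis hX : compact X.

Lemma model_measurable t : t \in `[(- M)%R, M] -> measurable_fun [set: Y] (f t).
Proof. by move=> /hf[]. Qed.

Lemma model_ge0 t y : t \in `[(- M)%R, M] -> (0 <= f t y)%R.
Proof. by move=> /hf[]. Qed.

Lemma log_mean_fin x s t : s \in `[(- M)%R, M] -> t \in `[(- M)%R, M] ->
  Edens mu (p0 x) (log_ratio (f s) (f t)) \is a fin_num.
Proof. by move=> sM tM; exact: (hlogcont.1 (x, s, t)). Qed.

Lemma power_mean_fin r x s t : r \in `[0%R, 1%R] ->
  s \in `[(- M)%R, M] -> t \in `[(- M)%R, M] ->
  Edens mu (p0 x) (fun y => poweR (dens_ratio (f s) (f t) y) r) \is a fin_num.
Proof. by move=> r01 sM tM; exact: ((hpowcont r01).1 (x, s, t)). Qed.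

Lemma dens_ratio_model_ge0 s t y : s \in `[(- M)%R, M] -> t \in `[(- M)%R, M] ->
  0 <= dens_ratio (f s) (f t) y.
Proof. by move=> sM tM; apply: dens_ratio_ge0; exact: model_ge0. Qed.

Let poweR1E s t : s \in `[(- M)%R, M] -> t \in `[(- M)%R, M] ->
  (fun y => poweR (dens_ratio (f s) (f t) y) 1) = dens_ratio (f s) (f t).
Proof.
by move=> sM tM; apply/funext => y; rewrite poweRe1// dens_ratio_model_ge0.
Qed.

Let itv01_1 : (1 : R)%R \in `[0%R, 1%R].
Proof. by rewrite in_itv/= ler01 lexx. Qed.

Lemma ratio_mean_fin x s t : s \in `[(- M)%R, M] -> t \in `[(- M)%R, M] ->
  Edens mu (p0 x) (dens_ratio (f s) (f t)) \is a fin_num.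
Proof.
by move=> sM tM; have := power_mean_fin x itv01_1 sM tM; rewrite poweR1E.
Qed.

(** On the diagonal the expected ratio is 1, hence close to 1 near the graph of
    any regression function. *)
Lemma ratio_mean_near_diag (th : X -> R) (eta : R) : continuous th ->
  (forall x, th x \in `[(- M)%R, M]) -> (0 < eta)%R ->
  exists2 r : R, (0 < r)%R & forall x s t,
    s \in `[(- M)%R, M] -> t \in `[(- M)%R, M] ->
    (`|th x - s| < r)%R -> (`|th x - t| < r)%R ->
    Edens mu (p0 x) (dens_ratio (f s) (f t)) <= (expR eta)%:E.
Proof.
move=> cth thM eta0.
have [_ cg] := hpowcont itv01_1.
have [r r0 hr] := uniform_near_graph (compact_set_type hX) cg cth cth
  (fun x => conj (thM x) (thM x)) eta0.
exists r => // x s t sM tM ths tht.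
have := hr x s t (conj sM tM) ths tht; rewrite /= !poweR1E//.
rewrite Edens_ratio_self ?log_mean_fin//; first last.
- by move=> y; exact: model_ge0.
- exact: model_measurable.
rewrite -[X in X <= _]fineK ?ratio_mean_fin// lee_fin /= => h.
apply: le_trans (expR_ge1Dx eta).
by move: h; rewrite ltr_norml => /andP[? _]; lra.
Qed.

(** For each covariate the difference quotients of r |-> E[(ratio)^r] decrease to
    the mean log-ratio; these are continuous in the covariate, so Dini's theorem
    provides one power r that serves them all, and 1 + z <= exp z concludes. *)
Lemma power_mean_le_drift (th1 th2 : X -> R) (eta : R) :
  continuous th1 -> continuous th2 ->
  (forall x, th1 x \in `[(- M)%R, M]) -> (forall x, th2 x \in `[(- M)%R, M]) ->
  (0 < eta)%R ->
  exists2 r : R, (0 < r)%R /\ r \in `[0%R, 1%R] & forall x,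
    Edens mu (p0 x) (fun y => poweR (dens_ratio (f (th1 x)) (f (th2 x)) y) r) <=
    (expR (r * (fine (Edens mu (p0 x) (log_ratio (f (th1 x)) (f (th2 x))))
       + eta)))%:E.
Proof.
move=> c1 c2 M1 M2 eta0.
have step_itv k : ((2^-1 : R) ^+ k)%R \in `[0%R, 1%R].
  by rewrite in_itv/= exprn_ge0 ?invr_ge0//= exprn_ile1 ?invr_ge0// invf_le1 ?ler1n.
pose E k x := Edens mu (p0 x)
  (fun y => poweR (dens_ratio (f (th1 x)) (f (th2 x)) y) (2^-1 ^+ k)).
pose G k x := (2 ^+ k * (fine (E k x) - 1))%R.
pose L x := fine (Edens mu (p0 x) (log_ratio (f (th1 x)) (f (th2 x)))).
have slope x := @power_mean_slope _ _ _ mu (p0 x) (f (th1 x)) (f (th2 x)) (hp0 x)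
  (model_measurable (M1 x)) (fun y => model_ge0 y (M1 x))
  (model_measurable (M2 x)) (fun y => model_ge0 y (M2 x))
  (log_mean_fin x (M1 x) (M2 x))
  (fun r r01 => power_mean_fin x r01 (M1 x) (M2 x)).
have graph x : box (x, th1 x, th2 x) by split; [exact: M1|exact: M2].
have cL : continuous L := continuous_along_graph hlogcont.2 c1 c2 graph.
have cG k : continuous (G k).
  have cE : continuous (fun x => fine (E k x)) :=
    continuous_along_graph (hpowcont (step_itv k)).2 c1 c2 graph.
  by move=> x; apply: (@cvgM _ _ (nbhs x) _ (cst (2 ^+ k)%R)
    (fun z => fine (E k z) - 1)%R (2 ^+ k)%R (fine (E k x) - 1)%R);
    [exact: cvg_cst | apply: cvgB; [exact: cE|exact: cvg_cst]].
have [k hk] := dini_upper (compact_set_type hX) cG cL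
  (fun k x => (slope x).1 k) (fun x => (slope x).2) eta0.
exists (2^-1 ^+ k)%R; first by split=> //; rewrite exprn_gt0 ?invr_gt0.
move=> x; rewrite -[X in X <= _]fineK ?power_mean_fin// lee_fin.
apply: (le_trans _ (expR_ge1Dx _)); rewrite -lerBlDl.
rewrite -(@ler_pM2l _ (2 ^+ k)) ?exprn_gt0// mulrA.
have -> : (2 ^+ k * 2^-1 ^+ k = 1 :> R)%R by rewrite -exprMn mulfV ?expr1n.
rewrite mul1r.
exact: (ltW (hk x)).
Qed.

End regression_model.

(** * The sampling distribution *)

Section sampling.
Local Open Scope ereal_scope.
Context (R : realType) (V : normedModType R) (X : set V)
  (d d' : measure_display) (Y : measurableType d) (Omega : measurableType d')
  (mu : {measure set Y -> \bar R}).
Variables (p0 : X -> Y -> R) (xs : nat -> X).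
Variables (P : probability Omega R) (Ys : nat -> {RV P >-> Y}).
Hypothesis hp0 : forall x, is_density mu (p0 x).
Hypothesis hindep : mutually_independent Ys.
Hypothesis hlaw : forall i (A : set Y), measurable A ->
  distribution P (Ys i) A = \int[mu]_(y in A) (p0 (xs i) y)%:E.

Lemma law_integralE i (g : Y -> \bar R) :
  measurable_fun [set: Y] g -> (forall y, 0 <= g y) ->
  \int[distribution P (Ys i)]_y g y = Edens mu (p0 (xs i)) g.
Proof.
move=> mg g0; have [mp pge0 _] := hp0 (xs i).
have := @integral_weighted_pushforward _ _ _ _ _ mu (distribution P (Ys i)) id
  (fun y => (p0 (xs i) y)%:E) (@measurable_id _ _ _).
move=> /(_ (iffRL (measurable_EFinP _ _) mp)) <- //.
by move=> A mA; rewrite [RHS]hlaw.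
Qed.

Lemma expectation_prod_le (g : nat -> Y -> \bar R) (c : nat -> R) n :
  (forall i, measurable_fun [set: Y] (g i)) -> (forall i y, 0 <= g i y) ->
  (forall i, Edens mu (p0 (xs i)) (g i) <= (expR (c i))%:E) ->
  \int[P]_w (\prod_(i < n) g i (Ys i w)) <= (expR (\sum_(i < n) c i))%:E.
Proof.
move=> mg g0 gc.
have E0 i : 0 <= Edens mu (p0 (xs i)) (g i).
  by rewrite -law_integralE//; exact: integral_ge0.
have Efin i : Edens mu (p0 (xs i)) (g i) \is a fin_num.
  by rewrite ge0_fin_numE// (le_lt_trans (gc i))// ltry.
under eq_integral do rewrite -(big_mkord xpredT (fun i => g i (Ys i _))).
rewrite expectation_prod_indep//; last 2 first.
- by move=> i; rewrite law_integralE.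
- exact: iota_uniq.
under eq_bigr do rewrite law_integralE// -[Edens _ _ _]fineK//.
rewrite prodEFin lee_fin big_mkord expR_sum; apply: ler_prod => i _.
by rewrite fine_ge0//= -lee_fin fineK.
Qed.

Lemma positive_obs_ae i (a : Y -> R) : measurable_fun [set: Y] a ->
  {ae mu, forall y, (0 < p0 (xs i) y -> 0 < a y)%R} ->
  {ae P, forall w, (0 < a (Ys i w))%R}.
Proof.
move=> ma hpos; have [mp pge0 _] := hp0 (xs i).
pose N := [set y | (a y <= 0)%R].
have mN : measurable N.
  have -> : N = [set: Y] `&` a @^-1` [set` `]-oo, 0%R]].
    by rewrite setTI; apply/seteqP; split=> y; rewrite /N /= in_itv.
  exact: ma.
exists (Ys i @^-1` N); split.
- exact: measurable_funPTI.
- have -> : P (Ys i @^-1` N) = distribution P (Ys i) N by [].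
  rewrite hlaw// -[RHS](integral0 mu N); apply: ge0_ae_eq_integral => //.
  - by apply/measurable_EFinP; exact: measurable_funTS.
  - by move=> y _; rewrite lee_fin.
  apply: filterS hpos => y ay Ny; congr _%:E; apply/eqP.
  rewrite eq_le pge0 andbT leNgt; apply/negP => /ay.
  by rewrite ltNge Ny.
- by move=> w /= /negP; rewrite -leNgt.
Qed.

End sampling.

(** * Integrated likelihood ratios *)

Section ereal_tools.
Local Open Scope ereal_scope.
Context (R : realType).

Lemma poweR_bigprod (I : Type) (s : seq I) (h : I -> \bar R) (r : R) :
  (forall i, 0 <= h i) ->
  poweR (\prod_(i <- s) h i) r = \prod_(i <- s) poweR (h i) r.
Proof.
move=> h0; elim: s => [|i s IH]; first by rewrite !big_nil poweR1r.
by rewrite !big_cons poweRM// ?prode_ge0// IH.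
Qed.

Lemma poweR_le_expR (y : \bar R) (r c : R) : 0 <= y -> (0 < r)%R ->
  poweR y r <= (expR (r * c))%:E -> y <= (expR c)%:E.
Proof.
move=> y0 r0 h.
have inI (z : \bar R) : 0 <= z -> z \in `[0, +oo] by move=> z0; rewrite in_itv/= z0 leey.
have rV0 : (0 <= r^-1)%R by rewrite invr_ge0 ltW.
have := gt0_ler_poweR rV0 (inI _ (poweR_ge0 y r)) (inI _ (le_trans (poweR_ge0 y r) h)) h.
rewrite -poweRrM mulfV ?gt_eqF// poweRe1// poweR_EFin.
by rewrite -expRM mulrAC mulfV ?mul1r ?gt_eqF.
Qed.

Lemma limn_einf_gt0_near (u : nat -> R) :
  0 < limn_einf (fun n => (u n)%:E) ->
  exists2 k : R, (0 < k)%R & \forall n \near \oo, (k <= u n)%R.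
Proof.
rewrite limn_einf_lim (cvg_lim _ (@cvg_einfs_sup _ _))// => /ereal_sup_gt[_ [N _ <-]].
rewrite /einfs /=; set A := sdrop _ _ => A0.
have Ale n : (N <= n)%N -> ereal_inf A <= (u n)%:E.
  by move=> Nn; apply: ereal_inf_lbound; exists n.
have finA : ereal_inf A \is a fin_num.
  by rewrite gt0_fin_numE// (le_lt_trans (Ale N (leqnn N)))// ltry.
exists (fine (ereal_inf A)); first by rewrite fine_gt0// A0 ltey_eq finA.
by exists N => // n /= Nn; rewrite -lee_fin fineK// Ale.
Qed.

End ereal_tools.

Section likelihood_ratios.
Local Open Scope ereal_scope.
Context (R : realType) (V : normedModType R) (X : set V)
  (d d' : measure_display) (Y : measurableType d) (Omega : measurableType d')
  (mu : {measure set Y -> \bar R}).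
Variables (M : R) (p0 : X -> Y -> R) (f : R -> Y -> R).
Hypothesis hp0 : forall x, is_density mu (p0 x).
Hypothesis hf : forall t, t \in `[(- M)%R, M] -> is_density mu (f t).
Hypothesis hfm : measurable_fun ([set` `[(- M)%R, M]] `*` [set: Y])
  (fun z : R * Y => f z.1 z.2).
Variables (xs : nat -> X) (P : probability Omega R) (Ys : nat -> {RV P >-> Y}).
Hypothesis hindep : mutually_independent Ys.
Hypothesis hlaw : forall i (A : set Y), measurable A ->
  distribution P (Ys i) A = \int[mu]_(y in A) (p0 (xs i) y)%:E.
Variable Pi : probability (unif_borel X) R.

Let box_fun (th : X -> R) := forall x, th x \in `[(- M)%R, M].

Lemma measurable_lik_ratio (W : set (X -> R)) (u v : (X -> R) -> X -> R) n :
  measurable (W : set (unif_borel X)) ->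
  (forall x, measurable_fun [set: unif_borel X] (fun th : unif_borel X => u th x)) ->
  (forall x, measurable_fun [set: unif_borel X] (fun th : unif_borel X => v th x)) ->
  (forall th, W th -> box_fun (u th)) -> (forall th, W th -> box_fun (v th)) ->
  measurable_fun ((W : set (unif_borel X)) `*` [set: Omega])
    (fun z => \prod_(i < n)
       dens_ratio (f (u z.1 (xs i))) (f (v z.1 (xs i))) (Ys i z.2)).
Proof.
move=> mW mu_ mv ubox vbox.
have mfu (t : (X -> R) -> X -> R) i :
    (forall x, measurable_fun [set: unif_borel X] (fun th : unif_borel X => t th x)) ->
    (forall th, W th -> box_fun (t th)) ->
    measurable_fun ((W : set (unif_borel X)) `*` [set: Omega])
      (fun z => f (t z.1 (xs i)) (Ys i z.2)).
  move=> mt tbox.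
  apply: (measurable_comp _ _ hfm (g := fun z : unif_borel X * Omega =>
    (t z.1 (xs i), Ys i z.2))).
  - by apply: measurableX => //; exact: measurable_itv.
  - by move=> _ [[th w] [/= Wth _] <-]; split => //=; exact: tbox.
  - apply: measurable_funTS; apply: measurable_fun_pair.
      exact: (measurableT_comp (mt (xs i)) measurable_fst).
    exact: (measurableT_comp (measurable_funPT (Ys i)) measurable_snd).
apply: emeasurable_bigprod => i; apply: emeasurable_funM.
  by apply/measurable_EFinP; exact: mfu.
by apply: (measurableT_comp (@measurable_inv_EFin R)); exact: mfu.
Qed.

(** Averaging over the prior commutes with the expectation, so a uniform bound on
    the one-observation mean ratios bounds the integrated likelihood ratio. *)
Lemma integrated_ratio_bound (W : set (X -> R)) (u v : (X -> R) -> X -> R)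
    (eta : R) :
  measurable (W : set (unif_borel X)) ->
  (forall x, measurable_fun [set: unif_borel X] (fun th : unif_borel X => u th x)) ->
  (forall x, measurable_fun [set: unif_borel X] (fun th : unif_borel X => v th x)) ->
  (forall th, W th -> box_fun (u th)) -> (forall th, W th -> box_fun (v th)) ->
  (forall th x, W th ->
     Edens mu (p0 x) (dens_ratio (f (u th x)) (f (v th x))) <= (expR eta)%:E) ->
  (0 < eta)%R ->
  {ae P, forall w, \forall n \near \oo,
    \int[Pi]_(th in W) (\prod_(i < n)
       dens_ratio (f (u th (xs i))) (f (v th (xs i))) (Ys i w)) <=
    (expR (n%:R * (2 * eta)))%:E}.
Proof.
move=> mW mu_ mv ubox vbox hE eta0.
pose F n (z : unif_borel X * Omega) := \prod_(i < n)
  dens_ratio (f (u z.1 (xs i))) (f (v z.1 (xs i))) (Ys i z.2).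
have mF n : measurable_fun ((W : set (unif_borel X)) `*` [set: Omega]) (F n).
  exact: measurable_lik_ratio.
have F0 n th w : W th -> 0 <= F n (th, w).
  by move=> Wth; apply: prode_ge0 => i _; apply: (dens_ratio_model_ge0 hf);
    [exact: ubox|exact: vbox].
apply: (@ae_exponential_bound _ _ _ P
  (fun n w => \int[Pi]_(th in W) F n (th, w)) 1 eta) => //.
- by move=> n; exact: (measurable_fun_partial_integral Pi mW (mF n) (F0 n)).
- by move=> n w; apply: integral_ge0 => th; exact: F0.
- lra.
apply: nearW => n; rewrite mul1r (tonelli_restricted Pi P mW (mF n) (F0 n)).
apply: (@le_trans _ _ (\int[Pi]_(th in W) (expR (n%:R * eta))%:E)).
  apply: ge0_le_integral => //.
  - by move=> th Wth; apply: integral_ge0 => w _; exact: F0.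
  - exact: (measurable_fun_partial_expectation P mW (mF n) (F0 n)).
  move=> th Wth.
  have := @expectation_prod_le _ _ _ _ _ _ _ mu p0 xs P Ys hp0 hindep hlaw
    (fun i => dens_ratio (f (u th (xs i))) (f (v th (xs i)))) (fun=> eta) n.
  rewrite sumr_const card_ord -[(eta *+ n)%R]mulr_natl; apply.
  - move=> i; apply: measurable_dens_ratio; apply: (model_measurable hf).
      exact: ubox.
    exact: vbox.
  - by move=> i y; apply: (dens_ratio_model_ge0 hf); [exact: ubox|exact: vbox].
  - by move=> i; exact: hE.
rewrite integral_cst// -[leRHS]mule1 lee_pmul2l ?lte_fin ?expR_gt0//.
exact: probability_le1.
Qed.

End likelihood_ratios.

(** * Exponential decay of the likelihood away from th* *)

Section likelihood_decay.
Local Open Scope ereal_scope.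
Context (R : realType) (V : normedModType R) (X : set V)
  (d d' : measure_display) (Y : measurableType d) (Omega : measurableType d')
  (mu : {measure set Y -> \bar R}).
Variables (M : R) (p0 : X -> Y -> R) (f : R -> Y -> R).
Hypothesis hp0 : forall x, is_density mu (p0 x).
Hypothesis hf : forall t, t \in `[(- M)%R, M] -> is_density mu (f t).
Hypothesis hlogcont : real_continuous_on
  [set z : X * R * R | z.1.2 \in `[(- M)%R, M] /\ z.2 \in `[(- M)%R, M]]
  (fun z => Edens mu (p0 z.1.1) (log_ratio (f z.1.2) (f z.2))).
Variables (xs : nat -> X) (P : probability Omega R) (Ys : nat -> {RV P >-> Y}).
Hypothesis hlaw : forall i (A : set Y), measurable A ->
  distribution P (Ys i) A = \int[mu]_(y in A) (p0 (xs i) y)%:E.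

Lemma model_density_pos_ae (th : X -> R) :
  (forall x, th x \in `[(- M)%R, M]) ->
  {ae P, forall w, forall i, (0 < f (th (xs i)) (Ys i w))%R}.
Proof.
move=> thM; apply: ae_foralln => i.
have mft := model_measurable hf (thM (xs i)).
apply: (positive_obs_ae hp0 hlaw) => //.
have ft0 y := model_ge0 hf y (thM (xs i)).
have := densities_pos_ae (hp0 (xs i)) mft ft0 mft ft0
  (log_mean_fin hlogcont (xs i) (thM (xs i)) (thM (xs i))).
by apply: filterS => y h /h[].
Qed.

Variable thstar : X -> R.
Hypothesis cstar : continuous thstar.
Hypothesis starM : forall x, thstar x \in `[(- M)%R, M].
Hypothesis hident : forall eta : R, (0 < eta)%R -> exists delta : R,
  (0 < delta < 1)%R /\ forall x t, t \in `[(- M)%R, M] ->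
  Edens mu (p0 x) (log_ratio (f (thstar x)) (f t)) < delta%:E ->
  (`|t - thstar x| < eta)%R.

Let drift (th : X -> R) x :=
  fine (Edens mu (p0 x) (log_ratio (f (th x)) (f (thstar x)))).

(** Swapping the two densities changes the sign of the mean log-ratio, so the
    identifiability condition bounds the drift from above. *)
Let drift_le (th : X -> R) (eta delta : R) x :
  (forall x t, t \in `[(- M)%R, M] ->
    Edens mu (p0 x) (log_ratio (f (thstar x)) (f t)) < delta%:E ->
    (`|t - thstar x| < eta)%R) ->
  th x \in `[(- M)%R, M] -> (eta <= `|th x - thstar x|)%R ->
  (drift th x <= - delta)%R.
Proof.
move=> hd thM far; have := hd x (th x) thM.
have fin := log_mean_fin hlogcont x (starM x) thM.
rewrite /drift (Edens_log_swap (hp0 x) (model_measurable hf (starM x))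
  (fun y => model_ge0 hf y (starM x)) (model_measurable hf thM)
  (fun y => model_ge0 hf y thM) fin).
rewrite -[X in X < _ -> _]fineK// lte_fin fineN lerN2.
case: (leP delta (fine (Edens mu (p0 x) (log_ratio (f (thstar x)) (f (th x)))))) => // _.
by move=> /(_ isT); rewrite ltNge far.
Qed.

(** If th and th* differ at x, identifiability at the scale of |th x - th* x|
    yields a strictly negative drift; otherwise the drift is its own opposite. *)
Lemma drift_le0 (th : X -> R) x : th x \in `[(- M)%R, M] -> (drift th x <= 0)%R.
Proof.
move=> thM; have [E|ne] := eqVneq (th x) (thstar x).
  have := Edens_log_swap (hp0 x) (model_measurable hf thM)
    (fun y => model_ge0 hf y thM) (model_measurable hf thM)
    (fun y => model_ge0 hf y thM) (log_mean_fin hlogcont x thM thM).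
  rewrite /drift -E => /(congr1 fine); rewrite fineN; lra.
have eta0 : (0 < `|th x - thstar x|)%R by rewrite normr_gt0 subr_eq0.
have [delta [/andP[d0 _] hd]] := hident eta0.
by have := drift_le hd thM (lexx _); lra.
Qed.

Hypothesis hindep : mutually_independent Ys.
Hypothesis hpowcont : forall r : R, r \in `[0%R, 1%R] -> real_continuous_on
  [set z : X * R * R | z.1.2 \in `[(- M)%R, M] /\ z.2 \in `[(- M)%R, M]]
  (fun z => Edens mu (p0 z.1.1)
     (fun y => poweR (dens_ratio (f z.1.2) (f z.2) y) r)).
Hypothesis hX : compact X.
Hypothesis hvisit : forall (x0 : X) (r : R), (0 < r)%R -> 0 < visit_liminf xs x0 r.

(** A regression function that differs from th* at one point differs from it on
    a ball, which a positive fraction of the covariates visits; each visit costs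
    a fixed amount of mean log-likelihood. *)
Lemma likelihood_decay (th : X -> R) (x0 : X) (eps : R) :
  continuous th -> (forall x, th x \in `[(- M)%R, M]) ->
  (0 < eps)%R -> (eps < `|th x0 - thstar x0|)%R ->
  exists2 c : R, (0 < c)%R & {ae P, forall w, \forall n \near \oo,
    \prod_(i < n) dens_ratio (f (th (xs i))) (f (thstar (xs i))) (Ys i w) <=
    (expR (n%:R * - c))%:E}.
Proof.
move=> cth thM eps0 far.
have [delta [/andP[d0 _] hd]] := hident eps0.
have [rad rad0 hrad] := gt_dist_ball cth cstar far.
have [kappa k0 hk] := limn_einf_gt0_near (hvisit x0 rad0).
pose A := [set x : X | (`|set_val x - set_val x0| < rad)%R].
(* half of the guaranteed drift rate delta * kappa is left for the error of the
   small-power approximation *)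
pose eta := (delta * kappa / 2)%R.
have eta0 : (0 < eta)%R by rewrite divr_gt0// mulr_gt0.
have [r [r0 r01] hr] :=
  power_mean_le_drift hp0 hf hlogcont hpowcont hX cth cstar thM starM eta0.
exists (eta / 2)%R; first by rewrite divr_gt0.
pose g i y := poweR (dens_ratio (f (th (xs i))) (f (thstar (xs i))) y) r.
have mg i : measurable_fun [set: Y] (g i).
  apply: (measurableT_comp (measurable_poweR r)); apply: measurable_dens_ratio.
    exact: (model_measurable hf).
  exact: (model_measurable hf).
have ratio0 i y : 0 <= dens_ratio (f (th (xs i))) (f (thstar (xs i))) y.
  exact: (dens_ratio_model_ge0 hf).
have driftA x : (drift th x <= - delta * \1_A x)%R.
  rewrite indicE; have [/set_mem xA|_] := boolP (x \in A); last first.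
    by rewrite mulr0 drift_le0.
  by rewrite mulr1; apply: drift_le hd _ _ => //; exact/ltW/hrad.
have sum_drift n : (kappa <= n%:R^-1 * \sum_(i < n) \1_A (xs i))%R ->
    (\sum_(i < n) r * (drift th (xs i) + eta) <= n%:R * (r * - eta))%R.
  case: n => [|n] h; first by rewrite big_ord0 mul0r.
  rewrite -mulr_sumr mulrCA ler_pM2l//.
  apply: (@le_trans _ _ (\sum_(i < n.+1) (- delta * \1_A (xs i) + eta))%R).
    by apply: ler_sum => i _; rewrite lerD2r.
  rewrite big_split/= sumr_const card_ord -mulr_sumr -[(eta *+ _)%R]mulr_natl.
  have n0 : (0 < n.+1%:R :> R)%R by rewrite ltr0n.
  move: h; rewrite -(ler_pM2l n0) mulrA mulfV ?gt_eqF// mul1r => h.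
  have := ler_wpM2l (ltW d0) h; rewrite /eta; move: (\sum_(i < n.+1) _)%R => S.
  by move: (n.+1%:R)%R => N; lra.
have := @ae_exponential_bound _ _ _ P
  (fun n w => \prod_(i < n) g i (Ys i w)) 1 (r * - eta) (r * - (eta / 2)).
case.
- by move=> n; apply: emeasurable_bigprod => i; exact: measurableT_comp.
- by move=> n w; apply: prode_ge0 => i _; exact: poweR_ge0.
- exact: ler01.
- by rewrite ltr_pM2l//; lra.
- apply: filterS hk => n hn.
  apply: le_trans (@expectation_prod_le _ _ _ _ _ _ _ mu p0 xs P Ys hp0 hindep hlaw
    g (fun i => r * (drift th (xs i) + eta))%R n mg _ _) _.
  + by move=> i y; exact: poweR_ge0.
  + by move=> i; exact: hr.
  + by rewrite lee_fin mul1r ler_expR; exact: sum_drift.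
move=> N [mN N0 hN]; exists N; split => // w Nw; apply: hN => h; apply: Nw.
move: h; apply: filterS => n.
rewrite -poweR_bigprod// => h.
apply: (poweR_le_expR _ r0); first exact: prode_ge0.
by rewrite mulrCA.
Qed.

End likelihood_decay.

(** * Posterior consistency *)

Section posterior_consistency.
Local Open Scope ereal_scope.
Context (R : realType) (V : normedModType R) (X : set V)
  (d d' : measure_display) (Y : measurableType d) (Omega : measurableType d')
  (mu : {measure set Y -> \bar R}).
Variables (M : R) (p0 : X -> Y -> R) (f : R -> Y -> R).
Hypothesis hp0 : forall x, is_density mu (p0 x).
Hypothesis hf : forall t, t \in `[(- M)%R, M] -> is_density mu (f t).
Hypothesis hfm : measurable_fun ([set` `[(- M)%R, M]] `*` [set: Y])
  (fun z : R * Y => f z.1 z.2).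
Variables (xs : nat -> X) (P : probability Omega R) (Ys : nat -> {RV P >-> Y}).
Hypothesis hindep : mutually_independent Ys.
Hypothesis hlaw : forall i (A : set Y), measurable A ->
  distribution P (Ys i) A = \int[mu]_(y in A) (p0 (xs i) y)%:E.
Variable Theta : set (X -> R).
Hypothesis hTheta : forall th, Theta th ->
  continuous th /\ (forall x, th x \in `[(- M)%R, M]).
Variable Pi : probability (unif_borel X) R.
Hypothesis hPi : Pi Theta = 1.
Variable thstar : X -> R.
Hypothesis hstar : Theta thstar.
Hypothesis hsupp : forall U : set {uniform X -> R}, open U -> U thstar -> 0 < Pi U.
Hypothesis hlogcont : real_continuous_on
  [set z : X * R * R | z.1.2 \in `[(- M)%R, M] /\ z.2 \in `[(- M)%R, M]]
  (fun z => Edens mu (p0 z.1.1) (log_ratio (f z.1.2) (f z.2))).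
Hypothesis hpowcont : forall r : R, r \in `[0%R, 1%R] -> real_continuous_on
  [set z : X * R * R | z.1.2 \in `[(- M)%R, M] /\ z.2 \in `[(- M)%R, M]]
  (fun z => Edens mu (p0 z.1.1)
     (fun y => poweR (dens_ratio (f z.1.2) (f z.2) y) r)).
Hypothesis hident : forall eta : R, (0 < eta)%R -> exists delta : R,
  (0 < delta < 1)%R /\ forall x t, t \in `[(- M)%R, M] ->
  Edens mu (p0 x) (log_ratio (f (thstar x)) (f t)) < delta%:E ->
  (`|t - thstar x| < eta)%R.
Hypothesis hX : compact X.
Hypothesis hThetac : compact (Theta : set {uniform X -> R}).
Hypothesis hvisit : forall (x0 : X) (r : R), (0 < r)%R -> 0 < visit_liminf xs x0 r.

Let mTheta : measurable (Theta : set (unif_borel X)).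
Proof. exact: uniform_compact_measurable. Qed.

Let cTh th : Theta th -> continuous th. Proof. by move=> /hTheta[]. Qed.

Let boxTh th : Theta th -> forall x, th x \in `[(- M)%R, M].
Proof. by move=> /hTheta[]. Qed.

Let mopen (W : set {uniform X -> R}) :
  open W -> measurable (W : set (unif_borel X)).
Proof. by move=> oW; apply: sub_sigma_algebra. Qed.

Let lik w n th := lik_ratio f thstar xs n (fun i => Ys i w) th.

Let lik_ge0 w n th : Theta th -> 0 <= lik w n th.
Proof.
move=> Tth; rewrite /lik /lik_ratio; apply: prode_ge0 => i _.
by apply: (dens_ratio_model_ge0 hf); exact: boxTh.
Qed.

Let mratio (u v : (X -> R) -> X -> R) w n :
  (forall x, measurable_fun [set: unif_borel X] (fun th : unif_borel X => u th x)) ->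
  (forall x, measurable_fun [set: unif_borel X] (fun th : unif_borel X => v th x)) ->
  (forall th, Theta th -> forall x, u th x \in `[(- M)%R, M]) ->
  (forall th, Theta th -> forall x, v th x \in `[(- M)%R, M]) ->
  measurable_fun (Theta : set (unif_borel X)) (fun th : unif_borel X =>
    \prod_(i < n) dens_ratio (f (u th (xs i))) (f (v th (xs i))) (Ys i w)).
Proof.
move=> mu_ mv ubox vbox.
have mprod := measurable_lik_ratio hfm xs Ys n mTheta mu_ mv ubox vbox.
apply: (measurable_comp _ _ mprod (g := fun th : unif_borel X => (th, w))).
- exact: measurableX.
- by move=> _ [th Tth <-].
- apply: measurable_funTS; apply: measurable_fun_pair => //.
Qed.

Let mlik w n : measurable_fun (Theta : set (unif_borel X)) (lik w n).
Proof.
apply: (mratio (u := id) (v := fun=> thstar)) => //.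
- exact: measurable_eval.
- by move=> _ _; exact: boxTh.
Qed.

(** Both directions are needed: ratios to th1 for the numerator of the posterior,
    reciprocal ratios (at th1 = th* ) for its denominator. *)
Let mean_ratio_nbhs (th1 : X -> R) (eta : R) : Theta th1 -> (0 < eta)%R ->
  exists W : set {uniform X -> R}, [/\ open W, W th1 &
    forall th x, (Theta `&` W) th ->
      Edens mu (p0 x) (dens_ratio (f (th x)) (f (th1 x))) <= (expR eta)%:E /\
      Edens mu (p0 x) (dens_ratio (f (th1 x)) (f (th x))) <= (expR eta)%:E].
Proof.
move=> T1 eta0.
have [r r0 hr] := ratio_mean_near_diag hp0 hf hlogcont hpowcont hX
  (cTh T1) (boxTh T1) eta0.
have := uniform_nbhs_ball th1 r0; rewrite nbhsE => -[W [oW W1] sW].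
exists W; split => // th x [Tth Wth].
have th1r : (`|th1 x - th1 x| < r)%R by rewrite subrr normr0.
have thr := sW _ Wth x.
by split; apply: hr => //; exact: boxTh.
Qed.

(** The evidence is at least the part coming from a neighbourhood of th*, and
    there the mean of the reciprocal likelihood ratio grows arbitrarily slowly. *)
Lemma evidence_lower_bound (eta : R) : (0 < eta)%R ->
  exists2 k : R, (0 < k)%R & {ae P, forall w, \forall n \near \oo,
    (k / expR (n%:R * (2 * eta)))%:E <= \int[Pi]_(th in Theta) lik w n th}.
Proof.
move=> eta0.
have [W [oW Wstar hW]] := mean_ratio_nbhs hstar eta0.
pose K : set (unif_borel X) := Theta `&` W.
have mW := mopen oW.
have mK : measurable K by exact: measurableI.
(* the support condition concerns W; intersecting with Theta, which has full
   prior mass, loses nothing *)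
have PK0 : 0 < Pi K.
  apply: (lt_le_trans (hsupp oW Wstar)).
  have Tc0 : Pi (~` (Theta : set (unif_borel X))) = 0.
    by rewrite probability_setC// hPi subee.
  rewrite -[leRHS]adde0 -Tc0.
  apply: le_trans (measureU2 _ mK (measurableC mTheta)).
  apply: le_measure; rewrite ?inE//.
    by apply: measurableU => //; exact: measurableC.
  by move=> th Wth; have [Tth|] := pselect (Theta th); [left|right].
pose k := fine (Pi K).
have PKE : Pi K = k%:E by rewrite fineK// fin_num_measure.
have k0 : (0 < k)%R by rewrite -lte_fin -PKE.
exists (k ^+ 2)%R; first by rewrite exprn_gt0.
have starM := boxTh hstar.
have hH := integrated_ratio_bound hp0 hf hfm hindep hlaw Pi (W := K)
  (u := fun=> thstar) (v := id) mK (fun x => measurable_cst _)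
  (@measurable_eval _ _ _) (fun _ _ => starM) (fun th Kth => boxTh Kth.1)
  (fun th x Kth => (hW th x Kth).2) eta0.
apply: filterS2 hH (model_density_pos_ae hp0 hf hlogcont hlaw starM) => w.
move=> + pos; apply: filterS => n hn.
have recip th : Theta th -> \prod_(i < n) dens_ratio (f (thstar (xs i)))
    (f (th (xs i))) (Ys i w) = (lik w n th)^-1.
  move=> Tth; pose r i := (f (th (xs i)) (Ys i w) / f (thstar (xs i)) (Ys i w))%R.
  have fge0 i : (0 <= f (th (xs i)) (Ys i w))%R.
    by apply: (model_ge0 hf); exact: boxTh.
  have r0 i : (0 <= r i)%R by rewrite divr_ge0// ltW.
  rewrite /lik /lik_ratio.
  rewrite [in RHS](eq_bigr (fun i : 'I_n => (r i)%:E)); last first.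
    by move=> i _; rewrite dens_ratioE.
  rewrite -(big_mkord xpredT (fun i => (r i)%:E)) inve_prod// big_mkord.
  apply: eq_bigr => i _; have := fge0 i; rewrite le0r => /predU1P[E|fi].
    by rewrite /dens_ratio /r E mul0r inve0 gt0_muley// lte_fin.
  by rewrite dens_ratioE// /r inver gt_eqF ?divr_gt0// invf_div.
have KT : K `<=` Theta by move=> th [].
apply: (@le_trans _ _ (\int[Pi]_(th in K) lik w n th)); last first.
  by apply: ge0_subset_integral => // th; exact: lik_ge0.
apply: integral_ge_inv => //.
- exact: measurable_funS (mlik w n).
- apply: (eq_measurable_fun (fun th : unif_borel X => \prod_(i < n)
    dens_ratio (f (thstar (xs i))) (f (th (xs i))) (Ys i w))).
    by move=> th /set_mem /KT; exact: recip.
  apply: measurable_funS (mratio (u := fun=> thstar) (v := id) _ _ _ _ _ _) => //.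
  exact: measurable_eval.
- by move=> th /KT; exact: lik_ge0.
- exact: expR_gt0.
- rewrite (eq_integral (fun th : unif_borel X => \prod_(i < n)
    dens_ratio (f (thstar (xs i))) (f (th (xs i))) (Ys i w))) => [//|th /set_mem /KT Tth].
  by rewrite recip.
Qed.

(** Factor the likelihood ratio through th1: the first factor decays, while the
    second has mean close to 1 uniformly over a neighbourhood of th1. *)
Lemma local_likelihood_decay (th1 : X -> R) (x0 : X) (eps : R) :
  Theta th1 -> (0 < eps)%R -> (eps < `|th1 x0 - thstar x0|)%R ->
  exists2 c : R, (0 < c)%R & exists W : set {uniform X -> R}, [/\ open W, W th1 &
    {ae P, forall w, \forall n \near \oo,
      \int[Pi]_(th in Theta `&` W) lik w n th <= (expR (n%:R * - c))%:E}].
Proof.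
move=> T1 eps0 far.
have starM := boxTh hstar; have oneM := boxTh T1.
have [c c0 hL] := likelihood_decay hp0 hf hlogcont hlaw (cTh hstar) starM hident
  hindep hpowcont hX hvisit (cTh T1) oneM eps0 far.
(* the second factor grows at rate at most 2 (c / 4), half the decay rate c *)
have eta0 : (0 < c / 4)%R by rewrite divr_gt0.
have [W [oW W1 hW]] := mean_ratio_nbhs T1 eta0.
exists (c / 2)%R; first by rewrite divr_gt0.
exists W; split => //.
pose K : set (unif_borel X) := Theta `&` W.
have mK : measurable K by apply: measurableI => //; exact: mopen.
have KT : K `<=` Theta by move=> th [].
have hZ := integrated_ratio_bound hp0 hf hfm hindep hlaw Pi (W := K)
  (u := id) (v := fun=> th1) mK (@measurable_eval _ _ _)
  (fun x => measurable_cst _) (fun th Kth => boxTh Kth.1) (fun _ _ => oneM)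
  (fun th x Kth => (hW th x Kth).1) eta0.
have pos1 := model_density_pos_ae hp0 hf hlogcont hlaw oneM.
have posstar := model_density_pos_ae hp0 hf hlogcont hlaw starM.
apply: filterS2 (filterI pos1 posstar) (filterI hL hZ) => w [f1 fs] [].
apply: filterS2 => n hLn hZn.
set Ln := \prod_(i < n) _ in hLn; set Zn := \int[Pi]_(th in K) _ in hZn.
have Ln0 : 0 <= Ln.
  by apply: prode_ge0 => i _; exact: (dens_ratio_model_ge0 hf).
have Zn0 : 0 <= Zn.
  apply: integral_ge0 => th Kth; apply: prode_ge0 => i _.
  by apply: (dens_ratio_model_ge0 hf) => //; exact: boxTh (KT _ Kth) _.
have -> : \int[Pi]_(th in K) lik w n th = Ln * Zn.
  rewrite -ge0_integralZl//; last 2 first.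
  - apply: measurable_funS (mratio (u := id) (v := fun=> th1) _ _ _ _ _ _) => //.
      exact: measurable_eval.
  - move=> th Kth; apply: prode_ge0 => i _.
    by apply: (dens_ratio_model_ge0 hf) => //; exact: boxTh (KT _ Kth) _.
  apply: eq_integral => th _.
  rewrite /lik /lik_ratio /Ln -big_split/=; apply: eq_bigr => i _.
  rewrite !dens_ratioE// -EFinM; congr _%:E.
  by rewrite [RHS]mulrC mulrA divfK// gt_eqF.
apply: (@le_trans _ _ ((expR (n%:R * - c))%:E * (expR (n%:R * (2 * (c / 4))))%:E)).
  exact: lee_pmul.
by rewrite -EFinM -expRD lee_fin ler_expR; move: (n%:R)%R => N; lra.
Qed.

Let post_on w n (A : set (X -> R)) := post f Pi Theta thstar xs n (fun i => Ys i w) A.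

Let evidence_ge0 w n : 0 <= \int[Pi]_(th in Theta) lik w n th.
Proof. by apply: integral_ge0 => th; exact: lik_ge0. Qed.

Let post_ge0 w n A : A `<=` Theta -> 0 <= post_on w n A.
Proof.
move=> AT; apply: mule_ge0; last by rewrite inve_ge0; exact: evidence_ge0.
by apply: integral_ge0 => th /AT; exact: lik_ge0.
Qed.

Let post_mono w n (A B : set (X -> R)) :
  measurable (A : set (unif_borel X)) -> measurable (B : set (unif_borel X)) ->
  A `<=` B -> B `<=` Theta -> post_on w n A <= post_on w n B.
Proof.
move=> mA mB AB BT; apply: lee_wpmul2r.
  by rewrite inve_ge0; exact: evidence_ge0.
apply: ge0_subset_integral => //; first exact: measurable_funS (mlik w n).
by move=> th /BT; exact: lik_ge0.
Qed.

Let post_union w n (A B : set (X -> R)) :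
  measurable (A : set (unif_borel X)) -> measurable (B : set (unif_borel X)) ->
  A `<=` Theta -> B `<=` Theta ->
  post_on w n (A `|` B) <= post_on w n A + post_on w n B.
Proof.
move=> mA mB AT BT.
have mBA : measurable (B `\` A : set (unif_borel X)) by exact: measurableD.
have -> : A `|` B = A `|` (B `\` A).
  by apply/seteqP; split=> th [Ath|Bth]; [left| |left|right; case: Bth] => //;
    have [Ath|nAth] := pselect (A th); [left|right].
have int0 C : C `<=` Theta -> 0 <= \int[Pi]_(th in C) lik w n th.
  by move=> CT; apply: integral_ge0 => th /CT; exact: lik_ge0.
apply: (@le_trans _ _ (post_on w n A + post_on w n (B `\` A))); last first.
  by apply: leeD => //; apply: post_mono => // th [].
rewrite /post_on /post -ge0_muleDl; [|exact: int0|by apply: int0 => th [/BT]].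
rewrite (@ge0_integral_setU _ _ _ Pi A (B `\` A))//.
- apply: measurable_funS (mlik w n) => //.
  by move=> th [/AT|[/BT]].
- by move=> th [/AT Tth|[/BT Tth _]]; exact: lik_ge0.
- by apply/disj_setPS => th [Ath [_]].
Qed.

Let squeeze0 w (A B : set (X -> R)) :
  measurable (A : set (unif_borel X)) -> measurable (B : set (unif_borel X)) ->
  A `<=` B -> B `<=` Theta -> post_on w n B @[n --> \oo] --> 0 ->
  post_on w n A @[n --> \oo] --> 0.
Proof.
move=> mA mB AB BT; apply: squeeze_cvge; last exact: cvg_cst.
apply: nearW => n; rewrite post_ge0; last exact: subset_trans BT.
exact: post_mono.
Qed.

Lemma local_posterior_decay (th1 : X -> R) (x0 : X) (eps : R) :
  Theta th1 -> (0 < eps)%R -> (eps < `|th1 x0 - thstar x0|)%R ->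
  exists W : set {uniform X -> R}, [/\ open W, W th1 &
    {ae P, forall w, post_on w n (Theta `&` W) @[n --> \oo] --> 0}].
Proof.
move=> T1 eps0 far.
have [c c0 [W [oW W1 hN]]] := local_likelihood_decay T1 eps0 far.
(* the evidence decays at rate at most 2 (c / 4), so the quotient still decays at
   rate c / 2 *)
have eta0 : (0 < c / 4)%R by rewrite divr_gt0.
have [k k0 hD] := evidence_lower_bound eta0.
exists W; split => //.
apply: filterS2 hN hD => w hN hD.
apply: (@squeeze_cvge _ _ _ _ (cst 0) _ (fun n => (k^-1 * expR (- (c / 2)) ^+ n)%:E)).
- near=> n; rewrite post_ge0/=; last by move=> th [].
  have D0 : (0 < k / expR (n%:R * (2 * (c / 4))))%R by rewrite divr_gt0 ?expR_gt0.
  apply: (@le_trans _ _ ((expR (n%:R * - c))%:E *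
      ((k / expR (n%:R * (2 * (c / 4))))%:E)^-1)).
    apply: lee_pmul.
    - by apply: integral_ge0 => th [Tth _]; exact: lik_ge0.
    - by rewrite inve_ge0; exact: evidence_ge0.
    - by near: n.
    - rewrite lee_pV2 ?inE; first by near: n.
      + exact: evidence_ge0.
      + by rewrite lee_fin ltW.
  have reorder (x y z : R) : (x * (y / z) = z^-1 * (x * y))%R by rewrite mulrA mulrC.
  rewrite inver gt_eqF// -EFinM lee_fin invf_div (reorder (expR _)) -expRD.
  rewrite ler_pM2l ?invr_gt0// -expRM_natl ler_expR.
  by move: (n%:R)%R => N; lra.
- exact: cvg_cst.
- apply: cvg_EFin; first exact: nearW.
  rewrite -[X in _ --> X](mulr0 k^-1%R); apply: cvgM; first exact: cvg_cst.
  apply: cvg_expr; rewrite gtr0_norm ?expR_gt0// expR_lt1.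
  by rewrite oppr_lt0 divr_gt0.
Unshelve. all: by end_near. Qed.

Let far_set (eps : R) : set (X -> R) :=
  [set th | Theta th /\ (eps < sup_dist th thstar)%R].

Let dist_le_2M (th : X -> R) : Theta th ->
  forall x, (`|th x - thstar x| <= 2 * M)%R.
Proof.
move=> Tth x; have := boxTh Tth x; have := boxTh hstar x.
rewrite !in_itv/= => /andP[? ?] /andP[? ?].
by rewrite ler_norml; apply/andP; split; lra.
Qed.

Let far_setE (eps : R) :
  far_set eps = Theta `&` [set th | exists x, (eps < `|th x - thstar x|)%R].
Proof.
apply/seteqP; split=> th [Tth] /(lt_sup_distP eps (xs 0) (dist_le_2M Tth)) far;
  by split.
Qed.

Let measurable_far_set (eps : R) :
  measurable (far_set eps : set (unif_borel X)).
Proof.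
rewrite far_setE; apply: measurableI => //.
exact: (mopen (open_far_from thstar eps)).
Qed.

(** Around a th1 within eps / 2 of th* a small ball misses the far set. *)
Let far_set_local_decay (eps : R) (th1 : X -> R) : (0 < eps)%R -> Theta th1 ->
  exists W : set {uniform X -> R}, [/\ open W, W th1 &
    {ae P, forall w, post_on w n (far_set eps `&` W) @[n --> \oo] --> 0}].
Proof.
move=> eps0 T1.
have e20 : (0 < eps / 2)%R by rewrite divr_gt0.
have e40 : (0 < eps / 4)%R by rewrite divr_gt0.
have mB := measurable_far_set eps.
have [[x0 far]|near] := pselect (exists x, (eps / 2 < `|th1 x - thstar x|)%R).
  have [W [oW W1 hW]] := local_posterior_decay T1 e20 far.
  exists W; split => //; apply: filterS hW => w.
  have mW := mopen oW.
  apply: squeeze0; [exact: measurableI..| |by move=> th []].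
  by move=> th [[Tth _] Wth].
have := uniform_nbhs_ball th1 e40; rewrite nbhsE => -[W [oW W1] sW].
exists W; split => //; apply/aeW => w.
rewrite (_ : far_set eps `&` W = set0).
  rewrite [X in X @ _ --> _](_ : _ = cst 0); first exact: cvg_cst.
  by apply/funext => n; rewrite /post_on /post integral_set0 mul0e.
apply/seteqP; split=> // th [] ; rewrite far_setE => -[_ [x far]] Wth.
apply: near; exists x; have := sW _ Wth x; have := ler_distD (th1 x) (th x) (thstar x).
rewrite (distrC (th x) (th1 x)); lra.
Qed.

(** Call W good when the posterior mass of the part of the far set in W tends to
    0. Good sets are closed under finite unions and every point of Theta has a
    good neighbourhood, so by compactness a good set contains Theta. Compactness
    is applied to the filter generated by the supersets of good sets. *)
Lemma posterior_far_set_cvg0 (eps : R) : (0 < eps)%R ->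
  {ae P, forall w, post_on w n (far_set eps) @[n --> \oo] --> 0}.
Proof.
move=> eps0; have mB := measurable_far_set eps.
have BT : far_set eps `<=` Theta by move=> th [].
pose good : set (set {uniform X -> R}) :=
  [set W | measurable (W : set (unif_borel X)) /\
    {ae P, forall w, post_on w n (far_set eps `&` W) @[n --> \oo] --> 0}].
have goodU W1 W2 : good W1 -> good W2 -> good (W1 `|` W2).
  move=> [m1 g1] [m2 g2]; split; first exact: measurableU.
  apply: filterS2 g1 g2 => w c1 c2; rewrite setIUr.
  apply: (@squeeze_cvge _ _ _ _ (cst 0) _ (fun n =>
    post_on w n (far_set eps `&` W1) + post_on w n (far_set eps `&` W2))).
  - apply: nearW => n; rewrite post_ge0/=; last by move=> t [] [/BT].
    apply: post_union; [exact: measurableI..| |].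
      by move=> t [/BT].
    by move=> t [/BT].
  - exact: cvg_cst.
  - by rewrite -[X in _ --> X]adde0; apply: cvgeD.
pose F := filter_from good (fun G => [set A | G `<=` A]).
have FF : Filter F.
  apply: filter_from_filter; last first.
    move=> G1 G2 g1 g2; exists (G1 `|` G2); first exact: goodU.
    by move=> A GA; split=> th Gth; apply: GA; [left|right].
  exists set0; split; first exact: measurable0.
  apply/aeW => w; rewrite setI0 [X in X @ _ --> _](_ : _ = cst 0).
    exact: cvg_cst.
  by apply/funext => n; rewrite /post_on /post integral_set0 mul0e.
have := (compact_near_coveringP _).1 hThetac _ F (fun A th => A th) FF.
case=> [th Tth|G [mG gG] GT].
  have [W [oW Wth gW]] := far_set_local_decay eps0 Tth.
  exists (W, [set A | W `<=` A]); last by move=> [th' A] /= [Wth' WA]; exact: WA.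
  split; first exact: open_nbhs_nbhs.
  by exists W => //; split=> //; exact: mopen.
have TG : Theta `<=` G by exact: (GT G).
by rewrite (_ : far_set eps = far_set eps `&` G)//; apply/esym/setIidPl => th /BT/TG.
Qed.

End posterior_consistency.

Theorem theorem3p1 (R : realType) (V : normedModType R) (X : set V)
  (d d' : measure_display) (Y : measurableType d) (Omega : measurableType d')
  (mu : {measure set Y -> \bar R})
  (M : R) (hM : 0 < M)
  (p0 : X -> Y -> R) (hp0 : forall x, is_density mu (p0 x))
  (f : R -> Y -> R) (hf : forall t, t \in `[- M, M] -> is_density mu (f t))
  (hfm : measurable_fun ([set` `[- M, M]] `*` [set: Y])
           (fun z : R * Y => f z.1 z.2))
  (xs : nat -> X)
  (P : probability Omega R) (Ys : nat -> {RV P >-> Y})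
  (hindep : mutually_independent Ys)
  (hlaw : forall i (A : set Y), measurable A ->
     distribution P (Ys i) A = (\int[mu]_(y in A) (p0 (xs i) y)%:E)%E)
  (Theta : set (X -> R))
  (hTheta : forall th, Theta th ->
     continuous th /\ (forall x, th x \in `[- M, M]))
  (Pi : probability (unif_borel X) R) (hPi : Pi Theta = 1%E)
  (thstar : X -> R) (hstar : Theta thstar)
  (hargmin : forall x t, t \in `[- M, M] ->
     (Edens mu (p0 x) (log_ratio (p0 x) (f (thstar x))) <=
      Edens mu (p0 x) (log_ratio (p0 x) (f t)))%E)
  (hsupp : forall U : set {uniform X -> R}, open U -> U thstar ->
     (0 < Pi U)%E)
  (hlogcont : real_continuous_on
     [set z : X * R * R | z.1.2 \in `[- M, M] /\ z.2 \in `[- M, M]]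
     (fun z => Edens mu (p0 z.1.1) (log_ratio (f z.1.2) (f z.2))))
  (hpowcont : forall alpha : R, alpha \in `[0, 1] -> real_continuous_on
     [set z : X * R * R | z.1.2 \in `[- M, M] /\ z.2 \in `[- M, M]]
     (fun z => Edens mu (p0 z.1.1)
        (fun y => poweR (dens_ratio (f z.1.2) (f z.2) y) alpha)))
  (hlog2 : exists C : R, forall x t t',
     t \in `[- M, M] -> t' \in `[- M, M] ->
     (Edens mu (p0 x) (fun y => log_ratio (f t) (f t') y ^+ 2) <= C%:E)%E)
  (hident : forall eta : R, 0 < eta -> exists delta : R,
     0 < delta < 1 /\
     forall x t, t \in `[- M, M] ->
       (Edens mu (p0 x) (log_ratio (f (thstar x)) (f t)) < delta%:E)%E ->
       `|t - thstar x| < eta)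
  (hX : compact X)
  (hThetac : compact (Theta : set {uniform X -> R}))
  (hvisit : forall (x0 : X) (r : R), 0 < r -> (0 < visit_liminf xs x0 r)%E) :
  forall eps : R, 0 < eps ->
    {ae P, forall w,
      post f Pi Theta thstar xs n (fun i => Ys i w)
        [set th | Theta th /\ eps < sup_dist th thstar]
      @[n --> \oo] --> 0%E}.
Proof.
exact: (posterior_far_set_cvg0 hp0 hf hfm hindep hlaw hTheta hPi hstar hsupp
  hlogcont hpowcont hident hX hThetac hvisit).
Qed.
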